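(* Let $\mathbb{K}$ be an infinite field, let $R=\mathbb{K}[[(\phi_1(t),\psi_1(u)),\ldots,(\phi_n(t),\psi_n(u))]]\subseteq\mathbb{K}[[t]]\times\mathbb{K}[[u]]$ be a two-branch algebroid curve, and let $c=(c[1],c[2])$ be the conductor of the value semigroup $\nu(R^* )$ of its Arf closure $R^*$. With $D(1,2)$, $Dis(1,2)$ and the vectors $b_O,b_D,b_G$ associated to $R$ as defined in the context, put $$b=\begin{cases} b_O & \text{if } D(1,2)\neq\emptyset;\\ \min\{b_D,b_G\} & \text{if } D(1,2)=\emptyset \text{ and } Dis(1,2)\ne\emptyset;\\ b_G & \text{if } D(1,2)=\emptyset\text{ and } Dis(1,2)=\emptyset.\end{cases}$$ Then $b\ge(c[1]+1,c[2]+1)$ componentwise.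
   Context: For $f=(\phi(t),\psi(u))\in\mathbb{K}[[t]]\times\mathbb{K}[[u]]$ put $\nu(f)=(\mathrm{ord}\,\phi,\mathrm{ord}\,\psi)$, with $\mathrm{ord}\,0=\infty$; vectors are compared, and minima of vectors taken, componentwise. $\mathbb{K}[[f_1,\ldots,f_n]]$ denotes the set of all power series in $f_1,\ldots,f_n$ (elements of positive order in each component), including constants; similarly in one variable. (When generators have nonzero constant terms it means the closure of the generated $\mathbb{K}$-subalgebra.) Two-branch algebroid curve (given by a parametrization): a ring $R=\mathbb{K}[[(\phi_1,\psi_1),\ldots,(\phi_n,\psi_n)]]$ with all $\phi_i,\psi_i$ of positive order, whose integral closure in its total ring of fractions is $\mathbb{K}[[t]]\times\mathbb{K}[[u]]$. Its branches are $R^1=\mathbb{K}[[\phi_1,\ldots,\phi_n]]$ and $R^2=\mathbb{K}[[\psi_1,\ldots,\psi_n]]$. Arf closure: a ring $A\subseteq\mathbb{K}[[t]]\times\mathbb{K}[[u]]$ is Arf if for every $x\in A$ with $\nu(x)=\alpha$ having finite components, $x^{-1}A(\alpha)$ is a ring, where $A(\alpha)=\{r\in A:\nu(r)\ge\alpha\}$. $R^*$ is the smallest Arf ring containing $R$; $\nu(R^* )$ is the set of values in $\mathbb{N}^2$ of elements of $R^*$, and its conductor is the smallest $c\in\mathbb{N}^2$ with $c+\mathbb{N}^2\subseteq\nu(R^* )$. Multiplicity sequences: for a branch $A=A_1\subseteq\mathbb{K}[[t]]$ let $A_{j+1}$ be the blow-up of $A_j$ (if $A_j=\mathbb{K}[[y_1,\ldots,y_k]]$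 with all $y_i$ of positive order and $x\in A_j$ has minimal positive order, then $A_{j+1}=\mathbb{K}[[x,y_1/x,\ldots,y_k/x]]$), and let $M[j]$ be the minimal positive order of an element of $A_j$. The sequence is nonincreasing and eventually $1$; its length is $l=\max\{j:M[j]\neq1\}$, with $l=1$ if $M=(1,1,\ldots)$. Let $M_1,M_2$ be the sequences of $R^1,R^2$ and $l_1,l_2$ their lengths. For each $k\ge1$ and $i=1,2$ there is a unique $s_{i,k}\ge k+1$ with $M_i[k]=\sum_{j=k+1}^{s_{i,k}}M_i[j]$. $D(1,2)=\{k: s_{1,k}\ne s_{2,k}\}$ (empty if and only if $M_1=M_2$). If $D(1,2)\neq\emptyset$, let $k_E(1,2)=\min\{\min(s_{1,k},s_{2,k}):k\in D(1,2)\}$, $d_i=\max\{l_i,k_E(1,2)\}$ and $$b_O=\Big(\sum_{j=1}^{d_1}M_1[j]+1,\ \sum_{j=1}^{d_2}M_2[j]+1\Big).$$ $Dis(1,2)=\{i:\mathrm{ord}(\phi_i)\neq\mathrm{ord}(\psi_i)\}$. If $D(1,2)=\emptyset$ and $Dis(1,2)\ne\emptyset$, let $D=\min\{\min\{\mathrm{ord}(\phi_i),\mathrm{ord}(\psi_i)\}:i\in Dis(1,2)\}$, $c_r=\sum_{j=1}^{l}M_1[j]$ with $l=l_1=l_2$, and $b_D=(\max\{c_r,D\}+1,\max\{c_r,D\}+1)$. $b_G$ is any vector produced by the following reduction process. A reduction step: order the generators so that $\nu(\phi_1,\psi_1)\le\nu(\phi_2,\psi_2)\le\cdots\le\nu(\phi_n,\psi_n)$;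 let $i>1$ be the first index such that $\phi_1(t)\ne\psi_1(t)$ or $\phi_i(t)\neq\psi_i(t)$; choose $a,b\in\mathbb{K}$ and positive integers $r,s$ such that $(\tilde\phi(t),\tilde\psi(u))=a(\phi_1(t),\psi_1(u))^r+b(\phi_i(t),\psi_i(u))^s$ satisfies $\mathrm{ord}(\tilde\phi)>\mathrm{ord}(\phi_1)$; replace $R$ by $\tilde R=\mathbb{K}[[(\tilde\phi,\tilde\psi),(\phi_2,\psi_2),\ldots,(\phi_n,\psi_n)]]\subseteq R$, which is required to be again a two-branch algebroid curve in $\mathbb{K}[[t]]\times\mathbb{K}[[u]]$, i.e. all components of its generators have positive order and its integral closure in its total ring of fractions is $\mathbb{K}[[t]]\times\mathbb{K}[[u]]$. Starting from $R$, perform at least one step and continue until reaching a curve for which $D(1,2)$ and $Dis(1,2)$ (computed for that curve and its parametrization) are not both empty. Then $b_G$ is the vector $b_O$ of that final curve if its $D(1,2)$ is nonempty, and the vector $b_D$ of that final curve otherwise. *)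

(* Defs.v *)
From HB Require Import structures.
From mathcomp Require Import all_boot all_order all_fingroup all_algebra.
From mathcomp Require Import boolp classical_sets cardinality.

Set Implicit Arguments.
Unset Strict Implicit.
Unset Printing Implicit Defensive.

Import GRing.Theory.
Local Open Scope classical_set_scope.
Local Open Scope ring_scope.

(** * The ring K[[t]] *)

(* A record rather than a bare function type, so that the pointwise ring
   structure on functions is never inferred in place of the Cauchy product. *)
Record fps (K : Type) := Fps { fps_coef :> nat -> K }.

Lemma fpsP (K : Type) (f g : fps K) : (forall m, f m = g m) -> f = g.
Proof. by case: f g => [f] [g] /= /funext ->. Qed.

HB.instance Definition _ (K : Type) := gen_eqMixin (fps K).
HB.instance Definition _ (K : Type) := gen_choiceMixin (fps K).

Section FpsRing.
Variable K : fieldType.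
Implicit Types f g h : fps K.

Definition fpsC (a : K) : fps K := Fps (fun m => if m == 0%N then a else 0).
Definition fps_opp f : fps K := Fps (fun m => - f m).
Definition fps_add f g : fps K := Fps (fun m => f m + g m).
Definition fps_mul f g : fps K :=
  Fps (fun m => \sum_(i < m.+1) f i * g (m - i)%N).

Fact fps_addA : associative fps_add.
Proof. by move=> f g h; apply: fpsP => m /=; rewrite addrA. Qed.
Fact fps_addC : commutative fps_add.
Proof. by move=> f g; apply: fpsP => m /=; rewrite addrC. Qed.
Fact fps_add0 : left_id (fpsC 0) fps_add.
Proof. by move=> f; apply: fpsP => m /=; case: eqP; rewrite add0r. Qed.
Fact fps_addN : left_inverse (fpsC 0) fps_opp fps_add.
Proof. by move=> f; apply: fpsP => m /=; rewrite addNr; case: eqP. Qed.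

HB.instance Definition _ :=
  GRing.isZmodule.Build (fps K) fps_addA fps_addC fps_add0 fps_addN.

Fact fps_mul_poly f g (N m : nat) : (m < N)%N ->
  fps_mul f g m = (\poly_(i < N) f i * \poly_(i < N) g i)`_m.
Proof.
move=> mN; rewrite coefM /=; apply: eq_bigr => i _.
have im : (i <= m)%N by rewrite -ltnS.
by rewrite !coef_poly (leq_ltn_trans im mN) (leq_ltn_trans (leq_subr i m) mN).
Qed.

Fact fps_mulC : commutative fps_mul.
Proof.
by move=> f g; apply: fpsP => m; rewrite !(@fps_mul_poly _ _ m.+1) // mulrC.
Qed.

Fact fps_mulA : associative fps_mul.
Proof.
move=> f g h; apply: fpsP => m.
transitivity ((\poly_(i < m.+1) f i *
    (\poly_(i < m.+1) g i * \poly_(i < m.+1) h i))`_m).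
  rewrite coefM /=; apply: eq_bigr => i _.
  rewrite coef_poly ltn_ord -(@fps_mul_poly g h m.+1) //.
  by rewrite ltnS leq_subr.
rewrite mulrA coefM /=; apply: eq_bigr => i _.
by rewrite -fps_mul_poly // coef_poly ltnS leq_subr.
Qed.

Fact fps_mul1 : left_id (fpsC 1) fps_mul.
Proof.
move=> f; apply: fpsP => m; rewrite /= big_ord_recl /= mul1r subn0.
by rewrite big1 ?addr0 // => i _; rewrite mul0r.
Qed.

Fact fps_mulDl : left_distributive fps_mul fps_add.
Proof.
move=> f g h; apply: fpsP => m; rewrite /= -big_split /=.
by apply: eq_bigr => i _; rewrite mulrDl.
Qed.

Fact fps_1neq0 : fpsC 1 != 0.
Proof.
by apply/eqP => /(congr1 (fun f : fps K => f 0%N)) /= /eqP; rewrite oner_eq0.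
Qed.

HB.instance Definition _ := GRing.Zmodule_isComNzRing.Build (fps K)
  fps_mulA fps_mulC fps_mul1 fps_mulDl fps_1neq0.

Definition fps_unit : {pred fps K} := fun f => `[< exists g, g * f = 1 >].
Definition fps_inv f : fps K :=
  if pselect (exists g, g * f = 1) is left h then projT1 (cid h) else f.

Fact fps_mulVx : {in fps_unit, left_inverse 1 fps_inv *%R}.
Proof.
move=> f /asboolP hf; rewrite /fps_inv.
by case: pselect => // h; case: (cid h).
Qed.
Fact fps_unitPl f g : g * f = 1 -> fps_unit f.
Proof. by move=> gf; apply/asboolP; exists g. Qed.
Fact fps_inv_out : {in [predC fps_unit], fps_inv =1 id}.
Proof.
move=> f /= nf; rewrite /fps_inv; case: pselect => // h.
by case/negP: nf; apply/asboolP.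
Qed.

HB.instance Definition _ := GRing.ComNzRing_hasMulInverse.Build (fps K)
  fps_mulVx fps_unitPl fps_inv_out.

Fact fps_lead f : f != 0 -> exists2 m, f m != 0 & forall k, (k < m)%N -> f k = 0.
Proof.
move=> f0; have ex : exists m, f m != 0.
  apply: contrapT => nex; case/eqP: f0; apply: fpsP => m.
  transitivity (0 : K); last by rewrite /=; case: eqP.
  by apply/eqP; apply: contrapT => /negP fm; apply: nex; exists m.
exists (ex_minn ex); case: ex_minnP => // m fm min k km.
by apply/eqP; apply: contraTT km => fk; rewrite -leqNgt min.
Qed.

Fact fps_idomain : GRing.integral_domain_axiom (fps K).
Proof.
move=> f g fg0; apply: contrapT => /negP; rewrite negb_or => /andP[].
move=> /fps_lead[m fm fk] /fps_lead[n gn gk].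
have /(congr1 (fun h : fps K => h (m + n)%N)) := fg0.
have -> : (f * g) (m + n)%N = f m * g n.
  have mlt : (m < (m + n).+1)%N by rewrite ltnS leq_addr.
  rewrite {1}/GRing.mul /= (bigD1 (Ordinal mlt)) //= addKn big1 ?addr0 // => i.
  rewrite -val_eqE /= neq_ltn => /orP[im|mi]; first by rewrite fk ?mul0r.
  have ile : (i <= m + n)%N by rewrite -ltnS.
  by rewrite gk ?mulr0 // ltn_subLR // ltn_add2r.
move=> /= /eqP; case: ifP => _; rewrite mulf_eq0 (negPf fm) (negPf gn) //.
Qed.

HB.instance Definition _ :=
  GRing.ComUnitRing_isIntegral.Build (fps K) fps_idomain.

End FpsRing.

(** * Orders and values; [None] stands for infinity *)

Definition leqx (x y : option nat) : bool :=
  match x, y with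
  | _, None => true
  | None, Some _ => false
  | Some m, Some n => (m <= n)%N
  end.
Definition ltx (x y : option nat) : bool := ~~ leqx y x.
Definition minx (x y : option nat) : option nat := if leqx x y then x else y.

Definition ord (K : fieldType) (f : fps K) : option nat :=
  if pselect (exists m, f m != 0) is left h then Some (ex_minn h) else None.

(* The ring K[[t]] x K[[u]]; both variables are the formal one of [fps K]. *)
Notation fps2 K := (fps K * fps K)%type.

Definition nu (K : fieldType) (f : fps2 K) : option nat * option nat :=
  (ord f.1, ord f.2).

Definition vlex (v w : option nat * option nat) : bool :=
  leqx v.1 w.1 && leqx v.2 w.2.
Definition vle (v w : nat * nat) : bool := (v.1 <= w.1)%N && (v.2 <= w.2)%N.
Definition vmin (v w : nat * nat) : nat * nat := (minn v.1 w.1, minn v.2 w.2).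

(* 0 on the empty set *)
Definition min_nat (P : set nat) : nat :=
  xget 0%N [set m | P m /\ forall k, P k -> (m <= k)%N].
(* [d] on a set that is empty or unbounded *)
Definition max_nat_dflt (d : nat) (P : set nat) : nat :=
  xget d [set m | P m /\ forall k, P k -> (k <= m)%N].

(** * Generated rings *)

Definition is_subring (S : nzRingType) (A : set S) : Prop :=
  [/\ A 1, forall x y, A x -> A y -> A (x - y)
    & forall x y, A x -> A y -> A (x * y)].

Section Generated.
Variable K : fieldType.

Definition pos_ord (f : fps K) : Prop := ltx (Some 0%N) (ord f).

(* F(y_1,...,y_k) for F = \sum_e c_e X^e.  When the y_i have positive order, a
   monomial y^e with some e_i > m does not contribute to the coefficient of
   index m, hence the finite sum. *)
Definition ps_subst (k : nat) (c : {ffun 'I_k -> nat} -> K)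
    (y : 'I_k -> fps K) : fps K :=
  Fps (fun m => \sum_(e : {ffun 'I_k -> 'I_m.+1})
         c [ffun i => e i : nat] * (\prod_(i < k) y i ^+ e i) m).

Definition is_subalg (A : set (fps K)) : Prop :=
  is_subring A /\ forall a : K, A (fpsC a).

Definition adic_closure (A : set (fps K)) : set (fps K) :=
  [set f | forall N, exists2 g, A g & forall m, (m < N)%N -> f m = g m].

(* K[[y_1,...,y_k]] in K[[t]] *)
Definition ps_ring (k : nat) (y : 'I_k -> fps K) : set (fps K) :=
  if pselect (forall i, pos_ord (y i)) is left _
  then [set f | exists c, f = ps_subst c y]
  else adic_closure (smallest is_subalg (range y)).

(* K[[p_1,...,p_n]] in K[[t]] x K[[u]], for p_i of positive orders *)
Definition ps_ring2 (n : nat) (p : 'I_n -> fps2 K) : set (fps2 K) :=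
  [set f | exists c, f = (ps_subst c (fun i => (p i).1),
                          ps_subst c (fun i => (p i).2))].

End Generated.

(** * Two-branch algebroid curves *)

Section Curve.
Variable K : fieldType.

(* K((t)) x K((u)), the total ring of fractions of K[[t]] x K[[u]] *)
Notation laurent2 := ({fraction (fps K)} * {fraction (fps K)})%type.

Definition to_laurent2 (f : fps2 K) : laurent2 :=
  (tofrac f.1, tofrac f.2).

Definition nonzerodivisor (A : set (fps2 K)) (s : fps2 K) : Prop :=
  A s /\ forall r, A r -> r * s = 0 -> r = 0.

(* The total ring of fractions of A, inside K((t)) x K((u)).  A priori a
   nonzerodivisor of A may fail to be invertible there; but if the fractions
   below include (1,0) and (0,1), then A contains some (a,0) and (0,b) with
   a, b <> 0, so that every nonzerodivisor of A is invertible. *)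
Definition total_fractions (A : set (fps2 K)) : set laurent2 :=
  [set z | exists r s, [/\ A r, nonzerodivisor A s,
     to_laurent2 s \is a GRing.unit & z = to_laurent2 r / to_laurent2 s]].

Definition integral_over (A : set (fps2 K)) (z : laurent2) : Prop :=
  exists P : {poly laurent2}, [/\ P \is monic,
    forall i, exists2 a, A a & P`_i = to_laurent2 a & P.[z] = 0].

Definition integral_closure (A : set (fps2 K)) : set laurent2 :=
  [set z | total_fractions A z /\ integral_over A z].

Definition two_branch_curve (n : nat) (p : 'I_n -> fps2 K) : Prop :=
  (forall i, pos_ord (p i).1 /\ pos_ord (p i).2) /\
  integral_closure (ps_ring2 p) = range to_laurent2.

(** * Arf closure *)

Definition is_arf (A : set (fps2 K)) : Prop :=
  is_subring A /\
  forall (x : fps2 K) (a : nat * nat), A x -> nu x = (Some a.1, Some a.2) ->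
    is_subring [set z | exists2 r, A r /\ vlex (nu x) (nu r) & x * z = r].

Definition arf_closure (A : set (fps2 K)) : set (fps2 K) := smallest is_arf A.

Definition value_set (A : set (fps2 K)) : set (nat * nat) :=
  [set a | exists2 x, A x & nu x = (Some a.1, Some a.2)].

Definition is_conductor (V : set (nat * nat)) (c : nat * nat) : Prop :=
  (forall a, vle c a -> V a) /\
  forall c', (forall a, vle c' a -> V a) -> vle c c'.

(** * Multiplicity sequences *)

Definition is_min_pos_ord (A : set (fps K)) (m : nat) : Prop :=
  [/\ (0 < m)%N, exists2 x, A x & ord x = Some m
    & forall x, A x -> pos_ord x -> leqx (Some m) (ord x)].

Definition fps_cons (k : nat) (x : fps K) (z : 'I_k -> fps K) :
  'I_k.+1 -> fps K := fun i => if unlift ord0 i is Some j then z j else x.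

(* The blow-up does not depend on y and x, so the union over all admissible
   choices is the common value; z_i is the quotient y_i / x. *)
Definition blowup (A : set (fps K)) : set (fps K) :=
  [set w | exists (k : nat) (y z : 'I_k -> fps K) (x : fps K),
    [/\ (forall i, pos_ord (y i)) /\ A = ps_ring y,
        A x, exists2 m, is_min_pos_ord A m & ord x = Some m,
        forall i, x * z i = y i
      & ps_ring (fps_cons x z) w]].

(* Sequences are indexed from 1; their value at 0 is irrelevant. *)
Definition mult_seq (A : set (fps K)) (j : nat) : nat :=
  xget 0%N (is_min_pos_ord (iter j.-1 blowup A)).

End Curve.

Definition seq_length (M : nat -> nat) : nat :=
  max_nat_dflt 1 [set j | (1 <= j)%N /\ M j <> 1%N].

(* s_k, for k >= 1 *)
Definition seq_s (M : nat -> nat) (k : nat) : nat :=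
  xget 0%N [set s | (k.+1 <= s)%N /\ M k = (\sum_(k.+1 <= j < s.+1) M j)%N].

(** * The bounds *)

Section Bounds.
Variables (K : fieldType) (n : nat).
Implicit Types (p q : 'I_n -> fps2 K) (b : nat * nat).

Definition branch1 p : set (fps K) := ps_ring (fun i => (p i).1).
Definition branch2 p : set (fps K) := ps_ring (fun i => (p i).2).
Definition M1 p : nat -> nat := mult_seq (branch1 p).
Definition M2 p : nat -> nat := mult_seq (branch2 p).

(* D(1,2) *)
Definition D12 p : set nat :=
  [set k | (1 <= k)%N /\ seq_s (M1 p) k <> seq_s (M2 p) k].

Definition kE p : nat :=
  min_nat [set minn (seq_s (M1 p) k) (seq_s (M2 p) k) | k in D12 p].

Definition bO p : nat * nat :=
  let d1 := maxn (seq_length (M1 p)) (kE p) in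
  let d2 := maxn (seq_length (M2 p)) (kE p) in
  ((\sum_(1 <= j < d1.+1) M1 p j).+1, (\sum_(1 <= j < d2.+1) M2 p j).+1)%N.

(* Dis(1,2) *)
Definition Dis p : set 'I_n := [set i | ord (p i).1 <> ord (p i).2].

Definition Dmin p : nat :=
  min_nat [set d | exists2 i, Dis p i & Some d = minx (ord (p i).1) (ord (p i).2)].

(* Used only if D(1,2) is empty, so that the two sequences coincide. *)
Definition bD p : nat * nat :=
  let cr := (\sum_(1 <= j < (seq_length (M1 p)).+1) M1 p j)%N in
  ((maxn cr (Dmin p)).+1, (maxn cr (Dmin p)).+1).

(* One reduction step from p to q: p is first reordered by the permutation
   sigma, and i1 is the index of the first generator (0 in 'I_n). *)
Definition reduction_step p q : Prop :=
  exists (sigma : 'S_n) (i1 i : 'I_n) (a b : K) (r s : nat),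
    let p' := fun j => p (sigma j) in
    let differ := fun j : 'I_n => (p' i1).1 <> (p' i1).2 \/ (p' j).1 <> (p' j).2 in
    let new := (fpsC a, fpsC a) * p' i1 ^+ r + (fpsC b, fpsC b) * p' i ^+ s in
    [/\ forall j k : 'I_n, (j <= k)%N -> vlex (nu (p' j)) (nu (p' k)),
        i1 = 0%N :> nat,
        [/\ (0 < i)%N, differ i
          & forall j : 'I_n, (0 < j < i)%N -> ~ differ j],
        [/\ (0 < r)%N, (0 < s)%N & ltx (ord (p' i1).1) (ord new.1)]
      & q = (fun j => if j == i1 then new else p' j) /\ two_branch_curve q].

(* [reduces_to p b]: b is a vector b_G produced from p. *)
Inductive reduces_to p b : Prop :=
| reduces_O q of reduction_step p q & D12 q !=set0 & b = bO q
| reduces_D q of reduction_step p q & D12 q = set0 & Dis q !=set0 & b = bD q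
| reduces_next q of reduction_step p q & D12 q = set0 & Dis q = set0
    & reduces_to q b.

(* [is_bound p b]: b is a value of the bound for p, for some choice of b_G. *)
Inductive is_bound p b : Prop :=
| bound_O of D12 p !=set0 & b = bO p
| bound_D bG of D12 p = set0 & Dis p !=set0 & reduces_to p bG
    & b = vmin (bD p) bG
| bound_G of D12 p = set0 & Dis p = set0 & reduces_to p b.

End Bounds.

(* Main.v *)
Require Import Defs.
From HB Require Import structures.
From mathcomp Require Import all_boot all_order all_fingroup all_algebra.
From mathcomp Require Import boolp classical_sets cardinality.
From mathcomp Require Import zify ring.

Set Implicit Arguments.
Unset Strict Implicit.
Unset Printing Implicit Defensive.

Import GRing.Theory.
Local Open Scope classical_set_scope.
Local Open Scope ring_scope.

(* Let B be the adic closure of the Arf closure; it has the same finite values.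
   Starting from B, blow up both branches at once: as long as B does not contain
   the idempotent (1, 0), a positive order in one component forces a positive
   order in the other, so B contains an x of value (M_1[j], M_2[j]), the ring
   x^-1 B(nu x) is again a closed Arf algebra, and it still projects densely onto
   the next blow-ups of the two branches.  Once (1, 0) lies in B, the ring is a
   product and every value from (sum M_1, sum M_2) on is attained, the sums
   running to indices from which the multiplicities are 1.  An f in B with
   ord f_1 = M_1[j] + ... + M_1[s-1] and ord f_2 > M_2[j] + ... + M_2[s-1]
   forces this to happen at level s at the latest, since dividing it successively by the
   x's leaves an element of order 0 in one component only.  For b_O one takes for
   f the element x of a level in D(1,2), for b_D a generator in Dis(1,2); for b_G,
   the generators obtained by reduction stay in B. *)

(** * Orders, adic limits and division for power series in one variable *)

Section Series.
Variable K : fieldType.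
Implicit Types f g h x z : fps K.

Lemma fps0E m : (0 : fps K) m = 0.
Proof. by rewrite {1}/GRing.zero /=; case: eqP. Qed.
Lemma fpsDE f g m : (f + g) m = f m + g m. Proof. by []. Qed.
Lemma fpsNE f m : (- f) m = - f m. Proof. by []. Qed.
Lemma fpsBE f g m : (f - g) m = f m - g m. Proof. by []. Qed.
Lemma fpsME f g m : (f * g) m = \sum_(i < m.+1) f i * g (m - i)%N.
Proof. by []. Qed.
Lemma fps1E m : (1 : fps K) m = (m == 0%N)%:R.
Proof. by rewrite {1}/GRing.one /=; case: eqP. Qed.
Lemma fpsCE (a : K) m : fpsC a m = if m == 0%N then a else 0.
Proof. by []. Qed.
Lemma fpsCME (a : K) f m : (fpsC a * f) m = a * f m.
Proof.
by rewrite fpsME big_ord_recl /= subn0 big1 ?addr0 // => i _; rewrite mul0r.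
Qed.

Lemma fpsC0 : fpsC 0 = 0 :> fps K. Proof. by []. Qed.
Lemma fpsC1 : fpsC 1 = 1 :> fps K. Proof. by []. Qed.
Lemma fpsCB (a b : K) : fpsC (a - b) = fpsC a - fpsC b.
Proof. by apply: fpsP => m /=; case: eqP => // _; rewrite subrr. Qed.
Lemma fpsCM (a b : K) : fpsC (a * b) = fpsC a * fpsC b.
Proof.
by apply: fpsP => m; rewrite fpsCME !fpsCE; case: eqP => // _; rewrite mulr0.
Qed.

Lemma fps_sumE I (r : seq I) (P : pred I) (F : I -> fps K) m :
  (\sum_(i <- r | P i) F i) m = \sum_(i <- r | P i) F i m.
Proof. by apply: (big_morph (fun f : fps K => f m)) => //; apply: fps0E. Qed.

(** Order at least n, with no separate case for f = 0. [ordge N (f - g)] is congruence modulo t^N,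
    the form that every adic approximation below takes. *)
Definition ordge n f := forall m, (m < n)%N -> f m = 0.

Lemma ordge_0 n : ordge n 0. Proof. by move=> m _; rewrite fps0E. Qed.
Lemma ordge_le m n f : (m <= n)%N -> ordge n f -> ordge m f.
Proof. by move=> mn fn k km; apply: fn; apply: leq_trans mn. Qed.
Lemma ordgeD n f g : ordge n f -> ordge n g -> ordge n (f + g).
Proof. by move=> fn gn k kn; rewrite fpsDE fn ?gn ?addr0. Qed.
Lemma ordgeN n f : ordge n f -> ordge n (- f).
Proof. by move=> fn k kn; rewrite fpsNE fn ?oppr0. Qed.
Lemma ordgeB n f g : ordge n f -> ordge n g -> ordge n (f - g).
Proof. by move=> fn gn; apply: ordgeD => //; apply: ordgeN. Qed.
Lemma ordgeM m n f g : ordge m f -> ordge n g -> ordge (m + n) (f * g).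
Proof.
move=> fm gn k kmn; rewrite fpsME big1 // => i _.
have [im|mi] := ltnP i m; first by rewrite fm ?mul0r.
by rewrite gn ?mulr0 //; have := ltn_ord i; lia.
Qed.
Lemma ordgeMl n f g : ordge n g -> ordge n (f * g).
Proof. exact: (@ordgeM 0). Qed.
Lemma ordgeMr n f g : ordge n f -> ordge n (f * g).
Proof. by rewrite mulrC; apply: ordgeMl. Qed.
Lemma ordgeX n m f : ordge n f -> ordge (m * n) (f ^+ m).
Proof.
by move=> fn; elim: m => [|m IH]; rewrite ?mul0n // exprS mulSn; apply: ordgeM.
Qed.
Lemma ordge_sym n f g : ordge n (f - g) -> ordge n (g - f).
Proof. by move=> /ordgeN; rewrite opprB. Qed.
Lemma ordge_trans n f g h : ordge n (f - g) -> ordge n (g - h) -> ordge n (f - h).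
Proof. by move=> fg gh; have := ordgeD fg gh; rewrite addrA subrK. Qed.
Lemma ordge_subP n f g : ordge n (f - g) <-> forall m, (m < n)%N -> f m = g m.
Proof.
split=> H m mn; first by apply/eqP; rewrite -subr_eq0 -fpsBE H.
by rewrite fpsBE H ?subrr.
Qed.
Lemma ordge_eq0 f : (forall n, ordge n f) -> f = 0.
Proof. by move=> H; apply: fpsP => m; rewrite fps0E (H m.+1). Qed.
Lemma ordge1P f : ordge 1 f <-> f 0%N = 0.
Proof. by split=> [->|f0 [|m]]. Qed.

Lemma ord_SomeP f n : ord f = Some n <-> ordge n f /\ f n != 0.
Proof.
rewrite /ord; case: pselect => [ex|nex]; last first.
  by split=> // -[_ fn]; case: nex; exists n.
case: ex_minnP => m fm min; split=> [[<-]|[fn fn0]].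
  split=> // k km; apply/eqP; apply: contraTT km => /min.
  by rewrite -leqNgt.
congr Some; apply/eqP; rewrite eqn_leq min //=.
by rewrite leqNgt; apply: contra fm => /fn ->.
Qed.

Lemma ord_leq f n : leqx (Some n) (ord f) <-> ordge n f.
Proof.
rewrite /ord; case: pselect => [ex|nex] /=; last first.
  split=> // _ m _; apply: contrapT => /eqP fm; apply: nex; by exists m.
case: ex_minnP => m fm min; split=> [nm k kn|fn].
  apply/eqP; apply: contraTT (leq_trans kn nm) => /min; by rewrite -leqNgt.
by rewrite leqNgt; apply: contra fm => /fn ->.
Qed.

Lemma pos_ordP f : pos_ord f <-> f 0%N = 0.
Proof.
rewrite /pos_ord /ltx -ordge1P -ord_leq.
by case: (ord f) => //= -[].
Qed.

Lemma ord_ge f n : ord f = Some n -> ordge n f.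
Proof. by case/ord_SomeP. Qed.
Lemma ord_le_ge f m n : ord f = Some n -> ordge m f -> (m <= n)%N.
Proof.
by move=> /ord_SomeP[_ fn] fm; rewrite leqNgt; apply: contra fn => /fm ->.
Qed.
Lemma ord_Some_neq0 f n : ord f = Some n -> f != 0.
Proof.
by move=> /ord_SomeP[_]; apply: contra => /eqP ->; rewrite fps0E.
Qed.
Lemma ord_ex f : f != 0 -> exists n, ord f = Some n.
Proof. by move=> /fps_lead[m fm lt]; exists m; apply/ord_SomeP. Qed.

Lemma ordM f g m n : ord f = Some m -> ord g = Some n ->
  ord (f * g) = Some (m + n)%N.
Proof.
move=> /ord_SomeP[fm f0] /ord_SomeP[gn g0]; apply/ord_SomeP; split.
  exact: ordgeM.
have mlt : (m < (m + n).+1)%N by lia.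
rewrite fpsME (bigD1 (Ordinal mlt)) //= addKn big1 ?addr0 ?mulf_neq0 // => i.
rewrite -val_eqE /= neq_ltn => /orP[im|mi]; first by rewrite fm ?mul0r.
by rewrite gn ?mulr0 //; have := ltn_ord i; lia.
Qed.

Lemma ordX f m n : ord f = Some m -> ord (f ^+ n) = Some (n * m)%N.
Proof.
move=> fm; elim: n => [|n IH]; last by rewrite exprS mulSn; apply: ordM.
by apply/ord_SomeP; split=> //; rewrite expr0 fps1E oner_eq0.
Qed.

Lemma ord_close f g n N : ord f = Some n -> (n < N)%N -> ordge N (f - g) ->
  ord g = Some n.
Proof.
move=> /ord_SomeP[fn f0] nN /ordge_subP fg; apply/ord_SomeP; split.
  by move=> m mn; rewrite -fg ?fn //; lia.
by rewrite -fg.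
Qed.

Lemma ordge_close f g n N : ordge n f -> (n <= N)%N -> ordge N (f - g) ->
  ordge n g.
Proof.
by move=> fn nN /(ordge_le nN) /ordge_sym gf; rewrite -(subrK f g); apply: ordgeD.
Qed.

Lemma ordge_cancel x z n k : ord x = Some n -> ordge (n + k) (x * z) -> ordge k z.
Proof.
move=> xn xz; have [->|/ord_ex[j zj]] := eqVneq z 0; first exact: ordge_0.
apply: ordge_le (ord_ge zj); have := ord_le_ge (ordM xn zj) xz; lia.
Qed.

Lemma ord_cancel x z n k : ord x = Some n -> ord (x * z) = Some (n + k)%N ->
  ord z = Some k.
Proof.
move=> xn xz.
have /ord_ex[j zj] : z != 0.
  by apply/eqP => z0; move: (ord_Some_neq0 xz); rewrite z0 mulr0 eqxx.
by have := ordM xn zj; rewrite xz zj => -[/addnI ->].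
Qed.

Definition fpsXn n : fps K := Fps (fun m => (m == n)%:R).

Lemma ord_Xn n : ord (fpsXn n) = Some n.
Proof.
apply/ord_SomeP; split=> [m mn|]; rewrite /= ?eqxx ?oner_eq0 //.
by rewrite (ltn_eqF mn).
Qed.

Lemma ordge_shift n f : ordge n f -> exists g, f = fpsXn n * g.
Proof.
move=> fn; exists (Fps (fun m => f (m + n)%N)); apply: fpsP => m.
rewrite fpsME; have [mn|nm] := ltnP m n.
  rewrite fn // big1 // => i _ /=; have := ltn_ord i.
  by case: eqP => [->|]; rewrite ?mul0r //; lia.
have nlt : (n < m.+1)%N by [].
rewrite (bigD1 (Ordinal nlt)) //= eqxx mul1r subnK // big1 ?addr0 // => i.
by rewrite -val_eqE /= => /negPf ->; rewrite mul0r.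
Qed.

(** The geometric series of h: if h has no constant term, powers beyond the m-th do not reach the
    coefficient of index m. *)
Definition fps_geom h : fps K := Fps (fun m => (\sum_(i < m.+1) h ^+ i) m).

Lemma fps_geomE h N : ordge 1 h -> ordge N (fps_geom h - \sum_(i < N) h ^+ i).
Proof.
move=> h1; apply/ordge_subP => m mN /=.
rewrite !fps_sumE -!(big_mkord xpredT (fun i => (h ^+ i) m)).
rewrite [RHS](@big_cat_nat _ _ _ m.+1) //= [X in _ = _ + X]big_nat_cond.
rewrite [X in _ = _ + X]big1 ?addr0 // => i.
rewrite andbT => /andP[mi _].
by have := @ordgeX 1 i h h1; rewrite muln1; apply.
Qed.

Lemma fps_geom_inv h : ordge 1 h -> (1 - h) * fps_geom h = 1.
Proof.
move=> h1; apply/eqP; rewrite -subr_eq0; apply/eqP; apply: ordge_eq0 => N.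
rewrite -(subrK (\sum_(i < N) h ^+ i) (fps_geom h)) mulrDr -addrA.
apply: ordgeD; first by apply: ordgeMl; apply: fps_geomE.
rewrite (_ : _ + _ = - (h ^+ N)); last first.
  rewrite (_ : h ^+ N = (h - 1) * (\sum_(i < N) h ^+ i) + 1); first by ring.
  by rewrite -subrX1 subrK.
by apply: ordgeN; have := @ordgeX 1 N h h1; rewrite muln1.
Qed.

Lemma adic_closureP A f : adic_closure A f <->
  forall N, exists2 g, A g & ordge N (f - g).
Proof.
by split=> H N; have [g Ag /ordge_subP fg] := H N; exists g => //; apply/ordge_subP.
Qed.

Lemma sub_adic_closure (A : set (fps K)) : A `<=` adic_closure A.
Proof. by move=> f Af N; exists f. Qed.

Lemma subset_adic_closure (A B : set (fps K)) :
  A `<=` B -> adic_closure A `<=` adic_closure B.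
Proof. by move=> AB f Af N; have [g /AB] := Af N; exists g. Qed.

Definition adic_closed (A : set (fps K)) := adic_closure A `<=` A.

Lemma adic_closure_closed A : adic_closed (adic_closure A).
Proof.
move=> f /adic_closureP H; apply/adic_closureP => N.
have [g /adic_closureP/(_ N)[h Ah gh] fg] := H N.
by exists h => //; apply: ordge_trans gh.
Qed.

Section Subalgebra.
Variable A : set (fps K).
Hypothesis HA : is_subalg A.

Lemma subalg1 : A 1. Proof. by case: HA => -[]. Qed.
Lemma subalgC a : A (fpsC a). Proof. by case: HA. Qed.
Lemma subalgB f g : A f -> A g -> A (f - g).
Proof. by case: HA => -[_ + _] _; apply. Qed.
Lemma subalgM f g : A f -> A g -> A (f * g).
Proof. by case: HA => -[_ _ +] _; apply. Qed.
Lemma subalg0 : A 0. Proof. by rewrite -(subrr 1); apply: subalgB; apply: subalg1. Qed.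
Lemma subalgN f : A f -> A (- f).
Proof. by move=> Af; rewrite -sub0r; apply: subalgB => //; apply: subalg0. Qed.
Lemma subalgD f g : A f -> A g -> A (f + g).
Proof. by move=> Af Ag; rewrite -(opprK g); apply: subalgB => //; apply: subalgN. Qed.
Lemma subalgX f n : A f -> A (f ^+ n).
Proof.
move=> Af; elim: n => [|n IH]; first by rewrite expr0; apply: subalg1.
by rewrite exprS; apply: subalgM.
Qed.
Lemma subalg_sum I (r : seq I) (P : pred I) (F : I -> fps K) :
  (forall i, P i -> A (F i)) -> A (\sum_(i <- r | P i) F i).
Proof. by move=> H; apply: (big_ind A subalg0 subalgD). Qed.

Lemma adic_closure_subalg : is_subalg (adic_closure A).
Proof.
split; last by move=> a; apply: sub_adic_closure; apply: subalgC.
split; first by apply: sub_adic_closure; apply: subalg1.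
  move=> f g /adic_closureP Hf /adic_closureP Hg; apply/adic_closureP => N.
  have [f' Af' ff] := Hf N; have [g' Ag' gg] := Hg N.
  exists (f' - g'); first exact: subalgB.
  by rewrite (_ : _ - _ = (f - f') - (g - g')); [apply: ordgeB | ring].
move=> f g /adic_closureP Hf /adic_closureP Hg; apply/adic_closureP => N.
have [f' Af' ff] := Hf N; have [g' Ag' gg] := Hg N.
exists (f' * g'); first exact: subalgM.
rewrite (_ : _ - _ = (f - f') * g + f' * (g - g')); last by ring.
by apply: ordgeD; [apply: ordgeMr | apply: ordgeMl].
Qed.

(** After scaling by its constant term, f is 1 - h with h of positive order, and the partial sums of
    the geometric series of h lie in A. *)
Lemma subalg_inv f : adic_closed A -> A f -> f 0%N != 0 -> exists2 g, A g & f * g = 1.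
Proof.
move=> clA Af f0; pose h := 1 - fpsC (f 0%N)^-1 * f.
have h1 : ordge 1 h.
  by apply/ordge1P; rewrite fpsBE fpsCME fps1E eqxx mulVf // subrr.
have Ah : A h by apply: subalgB; [exact: subalg1|apply: subalgM => //; exact: subalgC].
exists (fpsC (f 0%N)^-1 * fps_geom h).
  apply: subalgM; first exact: subalgC.
  apply: clA; apply/adic_closureP => N; exists (\sum_(i < N) h ^+ i).
    by apply: subalg_sum => i _; apply: subalgX.
  exact: fps_geomE.
by rewrite mulrA (_ : f * _ = 1 - h) ?fps_geom_inv // /h; ring.
Qed.

End Subalgebra.

Lemma subalgT : is_subalg [set: fps K]. Proof. by []. Qed.

Lemma fps_div x f n : ord x = Some n -> ordge n f -> exists z, x * z = f.
Proof.
move=> xn /ordge_shift[g ->]; have /ordge_shift[u xu] := ord_ge xn.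
have /ord_SomeP[_ u0] : ord u = Some 0%N.
  by apply: (ord_cancel (ord_Xn n)); rewrite -xu addn0.
have [|v _ uv] := subalg_inv subalgT _ (I : [set: fps K] u) u0; first by [].
by exists (v * g); rewrite xu -mulrA (mulrA u) uv mul1r.
Qed.

End Series.

(** * Closed generated subalgebras, monomials and substitution into power series *)

Section Generated.
Variable K : fieldType.
Implicit Types (f g h : fps K) (S A : set (fps K)).

Definition gen S := adic_closure (smallest (@is_subalg K) S).

Lemma smallest_subalg S : is_subalg (smallest (@is_subalg K) S).
Proof.
split=> [|a A [hA _]]; last exact: subalgC.
split=> [A [hA _]|f g Hf Hg A hA|f g Hf Hg A hA]; first exact: subalg1.
  by apply: (subalgB hA.1); [apply: Hf|apply: Hg].
by apply: (subalgM hA.1); [apply: Hf|apply: Hg].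
Qed.

Lemma gen_subalg S : is_subalg (gen S).
Proof. by apply: adic_closure_subalg; apply: smallest_subalg. Qed.

Lemma gen_closed S : adic_closed (gen S).
Proof. exact: adic_closure_closed. Qed.

Lemma sub_gen S : S `<=` gen S.
Proof. by move=> f Sf; apply: sub_adic_closure => A [_ SA]; apply: SA. Qed.

Lemma gen_min S A : is_subalg A -> adic_closed A -> S `<=` A -> gen S `<=` A.
Proof.
move=> hA clA SA f Hf; apply: clA; move: f Hf.
by apply: subset_adic_closure => f; apply; split.
Qed.

Lemma gen_sub S A : S `<=` gen A -> gen S `<=` gen A.
Proof. by move=> H; apply: gen_min => //; [apply: gen_subalg|apply: gen_closed]. Qed.

Variables (k : nat) (y : 'I_k -> fps K).
Implicit Types e : {ffun 'I_k -> nat}.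

Definition mono e : fps K := \prod_(i < k) y i ^+ e i.
Definition deg e : nat := (\sum_(i < k) e i)%N.

Lemma monoD e e' : mono e * mono e' = mono [ffun i => e i + e' i]%N.
Proof.
by rewrite /mono -big_split /=; apply: eq_bigr => i _; rewrite ffunE exprD.
Qed.

Lemma degD e e' : deg [ffun i => e i + e' i]%N = (deg e + deg e')%N.
Proof. by rewrite /deg -big_split /=; apply: eq_bigr => i _; rewrite ffunE. Qed.

Lemma mono0 : mono [ffun=> 0%N] = 1.
Proof. by rewrite /mono big1 // => i _; rewrite ffunE expr0. Qed.

Lemma mono1 i : mono [ffun j => (j == i) : nat] = y i.
Proof.
rewrite /mono (bigD1 i) //= ffunE eqxx expr1 big1 ?mulr1 // => j /negPf ji.
by rewrite ffunE ji expr0.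
Qed.

Lemma deg1 i : deg [ffun j => (j == i) : nat] = 1%N.
Proof.
rewrite /deg (bigD1 i) //= ffunE eqxx big1 // => j /negPf ji.
by rewrite ffunE ji.
Qed.

(** The linear span of the monomials of degree at least D. Keeping track of D later makes infinite
    sums of coefficient families finite at each exponent. *)
Inductive span_mono (D : nat) : fps K -> Prop :=
| span_mono0 : span_mono D 0
| span_mono_add a e h : (D <= deg e)%N -> span_mono D h ->
    span_mono D (fpsC a * mono e + h).

Lemma span_monoD D f g : span_mono D f -> span_mono D g -> span_mono D (f + g).
Proof.
move=> Hf Hg; elim: Hf => [|a e h De _ IH]; first by rewrite add0r.
by rewrite -addrA; apply: span_mono_add.
Qed.

Lemma span_mono_le D E f : (D <= E)%N -> span_mono E f -> span_mono D f.
Proof.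
move=> DE; elim=> [|a e h Ee _ IH]; first exact: span_mono0.
by apply: span_mono_add => //; apply: leq_trans Ee.
Qed.

Lemma span_mono_mul1 D E a e g : (D <= deg e)%N -> span_mono E g ->
  span_mono (D + E) (fpsC a * mono e * g).
Proof.
move=> De; elim=> [|b e' h Ee _ IH]; first by rewrite mulr0; apply: span_mono0.
rewrite mulrDr (_ : _ * (_ * _) = fpsC (a * b) * (mono e * mono e')); last first.
  by rewrite fpsCM; ring.
by rewrite monoD; apply: span_mono_add => //; rewrite degD leq_add.
Qed.

Lemma span_monoM D E f g : span_mono D f -> span_mono E g ->
  span_mono (D + E) (f * g).
Proof.
move=> Hf Hg; elim: Hf => [|a e h De _ IH]; first by rewrite mul0r; apply: span_mono0.
by rewrite mulrDl; apply: span_monoD => //; apply: span_mono_mul1.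
Qed.

Lemma span_monoC D a f : span_mono D f -> span_mono D (fpsC a * f).
Proof.
by move=> Hf; have := @span_mono_mul1 0 D a [ffun=> 0%N] f (leq0n _) Hf; rewrite mono0 mulr1.
Qed.

Lemma span_mono_y i : span_mono 1 (y i).
Proof.
have := @span_mono_add 1 1 [ffun j => (j == i) : nat] 0; rewrite deg1 mono1 fpsC1.
by rewrite mul1r addr0; apply => //; apply: span_mono0.
Qed.

Lemma span_mono_subalg : is_subalg (span_mono 0).
Proof.
have HC a : span_mono 0 (fpsC a).
  have := @span_mono_add 0 a [ffun=> 0%N] 0; rewrite mono0 mulr1 addr0.
  by apply=> //; apply: span_mono0.
split=> //; split=> [|f g Hf Hg|f g Hf Hg]; first by rewrite -fpsC1.
  apply: span_monoD => //; have := span_monoC (-1) Hg.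
  by rewrite -[-1]sub0r fpsCB fpsC0 fpsC1 sub0r mulN1r.
exact: (span_monoM Hf Hg).
Qed.

Lemma smallest_span_mono : smallest (@is_subalg K) (range y) `<=` span_mono 0.
Proof.
move=> f; apply; split; first exact: span_mono_subalg.
by move=> _ [i _ <-]; apply: span_mono_le (span_mono_y i).
Qed.

Lemma mono_in A e : is_subalg A -> range y `<=` A -> A (mono e).
Proof.
move=> hA yA; rewrite /mono; apply: (big_ind A).
- exact: subalg1.
- exact: subalgM.
- by move=> i _; apply: subalgX => //; apply: yA; exists i.
Qed.

Section Positive.
Hypothesis pos_y : forall i, pos_ord (y i).

Lemma ordge_mono e : ordge (deg e) (mono e).
Proof.
rewrite /mono /deg; apply: (big_ind2 (fun f n => ordge n f)) => //.
  by move=> f m g n fm gn; apply: ordgeM.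
move=> i _; have := @ordgeX K 1 (e i) (y i); rewrite muln1; apply.
by apply/ordge1P/pos_ordP.
Qed.

Lemma leq_deg e i : (e i <= deg e)%N.
Proof. by rewrite /deg (bigD1 i) //= leq_addr. Qed.

Definition nat_of_exp N (e : {ffun 'I_k -> 'I_N}) : {ffun 'I_k -> nat} :=
  [ffun i => e i : nat].

(** A monomial with an exponent above m has order above m, so the box of exponents may be enlarged
    to one common to many coefficients. *)
Lemma ps_substE c N m : (m < N)%N ->
  ps_subst c y m =
  \sum_(e : {ffun 'I_k -> 'I_N}) c (nat_of_exp e) * mono (nat_of_exp e) m.
Proof.
move=> mN; rewrite (bigID (fun e : {ffun 'I_k -> 'I_N} => [forall i, (e i <= m)%N])) /=.
rewrite [X in _ = _ + X]big1 ?addr0 => [|e]; last first.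
  rewrite negb_forall => /existsP[i]; rewrite -ltnNge => mi.
  rewrite ordge_mono ?mulr0 //; apply: leq_trans mi _.
  by have := leq_deg (nat_of_exp e) i; rewrite ffunE.
pose w (e : {ffun 'I_k -> 'I_m.+1}) : {ffun 'I_k -> 'I_N} :=
  [ffun i => widen_ord mN (e i)].
pose w' (e : {ffun 'I_k -> 'I_N}) : {ffun 'I_k -> 'I_m.+1} := [ffun i => inord (e i)].
rewrite (reindex_onto w w') /=; last first.
  move=> e /forallP em; apply/ffunP => i; apply: val_inj.
  by rewrite !ffunE /= inordK // ltnS.
apply: eq_big => [e|e _].
  apply/esym/andP; split; first by apply/forallP => i; rewrite ffunE /= -ltnS.
  apply/eqP/ffunP => i; apply: val_inj; rewrite !ffunE /= inordK //.
congr (c _ * _); first by apply/ffunP => i; rewrite !ffunE.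
by congr (fps_coef _ m); apply: eq_bigr => i _; rewrite !ffunE.
Qed.

Lemma ps_subst_lin a c d :
  ps_subst (fun e => a * c e + d e) y = fpsC a * ps_subst c y + ps_subst d y.
Proof.
apply: fpsP => m; rewrite fpsDE fpsCME /= mulr_sumr -big_split /=.
by apply: eq_bigr => e _; rewrite mulrDl mulrA.
Qed.

Lemma ps_subst0 : ps_subst (fun=> 0) y = 0.
Proof. by apply: fpsP => m; rewrite fps0E /= big1 // => e _; rewrite mul0r. Qed.

Lemma ps_subst_mono e0 : ps_subst (fun e => (e == e0)%:R) y = mono e0.
Proof.
apply: fpsP => m; pose N := maxn m (deg e0).
rewrite (@ps_substE _ N.+1) ?ltnS ?leq_maxl //.
pose e1 : {ffun 'I_k -> 'I_N.+1} := [ffun i => inord (e0 i)].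
have e1E : nat_of_exp e1 = e0.
  apply/ffunP => i; rewrite !ffunE inordK // ltnS.
  by apply: leq_trans (leq_deg _ _) _; apply: leq_maxr.
rewrite (bigD1 e1) //= e1E eqxx mul1r big1 ?addr0 // => e ne.
case: eqP => [ee|]; rewrite ?mul0r //; case/eqP: ne.
by apply/ffunP => i; apply: val_inj; move/ffunP: ee => /(_ i); rewrite -e1E !ffunE.
Qed.

Lemma span_mono_subst D h : span_mono D h ->
  exists2 c, (forall e, (deg e < D)%N -> c e = 0) & h = ps_subst c y.
Proof.
elim=> [|a e0 g De _ [c cD ->]]; first by exists (fun=> 0); rewrite ?ps_subst0.
exists (fun e => a * (e == e0)%:R + c e); last by rewrite ps_subst_lin ps_subst_mono.
move=> e eD; rewrite cD // addr0; case: eqP => [ee|_]; last by rewrite mulr0.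
by move: eD; rewrite ee ltnNge De.
Qed.

Lemma ps_subst_approx c N : ordge N (ps_subst c y -
  \sum_(e : {ffun 'I_k -> 'I_N}) fpsC (c (nat_of_exp e)) * mono (nat_of_exp e)).
Proof.
apply/ordge_subP => m mN; rewrite (ps_substE _ mN) fps_sumE.
by apply: eq_bigr => e _; rewrite fpsCME.
Qed.

Lemma ps_subst_gen c : gen (range y) (ps_subst c y).
Proof.
apply/adic_closureP => N; eexists; last exact: ps_subst_approx.
have hA := smallest_subalg (range y).
apply: subalg_sum => // e _; apply: (subalgM hA); first exact: subalgC.
by apply: mono_in => // f fy A [_]; apply.
Qed.

Lemma ps_ring_pos : ps_ring y = [set f | exists c, f = ps_subst c y].
Proof. by rewrite /ps_ring; case: pselect => // -[]. Qed.

End Positive.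
End Generated.

(** * The power series in the generators form a closed subalgebra *)

Section PowerSeriesRing.
Variables (K : fieldType) (k : nat) (y : 'I_k -> fps K).
Hypothesis pos_y : forall i, pos_ord (y i).
Variables (i0 : 'I_k) (m : nat).
Hypothesis ord_y0 : ord (y i0) = Some m.

Let m_gt0 : (0 < m)%N.
Proof.
case: m ord_y0 => // /ord_SomeP[_]; have /pos_ordP -> := pos_y i0.
by rewrite eqxx.
Qed.

Let A := smallest (@is_subalg K) (range y).

(* The least orders in A of the residue classes mod m (an Apery set) are
   bounded by N0. *)
Lemma apery_bound : exists N0, forall f n, A f -> ord f = Some n ->
  exists g j, [/\ A g, ord g = Some j, (j <= N0)%N, (j <= n)%N & j = n %[mod m]].
Proof.
have res r : exists Nr, forall f n, A f -> ord f = Some n -> (n %% m)%N = r ->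
    exists g j, [/\ A g, ord g = Some j, (j <= Nr)%N, (j <= n)%N & j = n %[mod m]].
  pose P j := `[< exists g, [/\ A g, ord g = Some j & (j %% m)%N = r] >].
  have [ex|nex] := pselect (exists j, P j); last first.
    exists 0%N => f n Af fn nr; case: nex; exists n; apply/asboolP.
    by exists f; split.
  exists (ex_minn ex); case: ex_minnP => j /asboolP[g [Ag gj jr]] min f n Af fn nr.
  exists g, j; split=> //; last by rewrite jr nr.
  by apply: min; apply/asboolP; exists f.
have [F HF] := choice res; exists (\sum_(r < m) F r)%N => f n Af fn.
have rm : (n %% m < m)%N by rewrite ltn_mod.
have [g [j [Ag gj jF jn jm]]] := HF _ f n Af fn erefl.
exists g, j; split=> //; apply: leq_trans jF _.
by rewrite (bigD1 (Ordinal rm)) //= leq_addr.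
Qed.

(* The degrees of the monomials tend to infinity with n, so that successive
   approximations add up to a power series in the y_i. *)
Lemma gen_lead : exists N0, forall n g, gen (range y) g -> ordge n g ->
  exists c, [/\ forall e, (deg e < (n - N0) %/ m)%N -> c e = 0,
    gen (range y) (g - ps_subst c y) & ordge n.+1 (g - ps_subst c y)].
Proof.
have [N0 HN0] := apery_bound; exists N0 => n g Hg gn.
have [gn0|gn0] := eqVneq (g n) 0.
  exists (fun=> 0); rewrite ps_subst0 subr0; split=> // l.
  by rewrite ltnS leq_eqVlt => /orP[/eqP ->|/gn].
have ordg : ord g = Some n by apply/ord_SomeP.
have [a Aa ga] := (adic_closureP _ _).1 Hg n.+1.
have [h [j [Ah hj jN jn /eqP jm]]] := HN0 a n Aa (ord_close ordg (ltnSn n) ga).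
rewrite eq_sym eqn_mod_dvd // in jm; have [q njq] := dvdnP jm.
(* Since n = q m + j, this s has the order of g; its q factors [y i0] put it in degree at least q =
   (n - j) / m, which is at least (n - N0) / m. *)
pose s := y i0 ^+ q * h.
have ords : ord s = Some n.
  by rewrite /s (_ : n = q * m + j)%N; [apply: ordM => //; apply: ordX|lia].
have [c cq sc] : exists2 c, (forall e, (deg e < q)%N -> c e = 0) & s = ps_subst c y.
  apply: (span_mono_subst pos_y); rewrite -[q]addn0; apply: span_monoM.
    elim: q {s ords njq} => [|q IH].
      by rewrite expr0; apply: subalg1; apply: span_mono_subalg.
    by rewrite exprS -add1n; apply: span_monoM => //; apply: span_mono_y.
  exact: smallest_span_mono.
have /ord_SomeP[sn sn0] := ords.
pose b := g n / s n; exists (fun e => b * c e + 0).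
rewrite (ps_subst_lin _ b c (fun=> 0)) ps_subst0 addr0 -sc; split.
- move=> e eD; rewrite cq ?mulr0 ?addr0 //; apply: leq_trans eD _.
  have -> : q = ((n - j) %/ m)%N by rewrite njq mulnK.
  by apply: leq_div2r; lia.
- have hG := gen_subalg (range y).
  apply: (subalgB hG) => //; apply: (subalgM hG); first exact: subalgC.
  apply: sub_adic_closure; have hA := smallest_subalg (range y).
  by apply: (subalgM hA) => //; apply: (subalgX hA) => B [_]; apply; exists i0.
- move=> l; rewrite ltnS leq_eqVlt fpsBE fpsCME => /orP[/eqP ->|ln].
    by rewrite /b divfK // subrr.
  by rewrite gn // sn // mulr0 subrr.
Qed.

(** Leading terms are removed one order at a time. The corrections involve monomials of growing
    degree only, so at each exponent finitely many of them contribute and they add up to a single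
    coefficient family. *)
Lemma gen_ps_ring_sub : gen (range y) `<=` ps_ring y.
Proof.
move=> f Hf; rewrite ps_ring_pos //.
have [N0 HN0] := gen_lead.
have step (ng : nat * fps K) : exists c, gen (range y) ng.2 -> ordge ng.1 ng.2 ->
  [/\ forall e, (deg e < (ng.1 - N0) %/ m)%N -> c e = 0,
    gen (range y) (ng.2 - ps_subst c y) & ordge ng.1.+1 (ng.2 - ps_subst c y)].
  case: ng => n g /=; have [[Hg gn]|H] := pselect (gen (range y) g /\ ordge n g).
    by have [c ?] := HN0 n g Hg gn; exists c.
  by exists (fun=> 0) => Hg gn; case: H.
have [c Hc] := choice step.
pose F := fix F n := if n is n'.+1 then F n' - ps_subst (c (n', F n')) y else f.
have FP n : gen (range y) (F n) /\ ordge n (F n).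
  elim: n => [|n [IH1 IH2]] //=.
  by have [_ ? ?] := Hc (n, F n) IH1 IH2.
pose d n := c (n, F n).
have d0 n e : (deg e < (n - N0) %/ m)%N -> d n e = 0.
  by have [IH1 IH2] := FP n; have [+ _ _] := Hc (n, F n) IH1 IH2; apply.
(* From index [B D] on, (n - N0) / m exceeds D, so the corrections vanish on all exponents of degree
   at most D. *)
pose B (D : nat) := (m * D.+1 + N0)%N.
have dB n e : (B (deg e) <= n)%N -> d n e = 0.
  move=> Bn; apply: d0; rewrite leq_divRL //.
  by move: Bn; rewrite /B mulnC; lia.
have fE n : f = F n + ps_subst (fun e => \sum_(l < n) d l e) y.
  elim: n => [|n IH].
    rewrite (_ : (fun _ => _) = (fun=> 0)) ?ps_subst0 ?addr0 //.
    by apply/funext => e; rewrite big_ord0.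
  rewrite {1}IH /=.
  rewrite (_ : (fun e => \sum_(l < n.+1) d l e) =
    (fun e => 1 * d n e + \sum_(l < n) d l e)); last first.
    by apply/funext => e; rewrite big_ord_recr /= mul1r addrC.
  by rewrite ps_subst_lin fpsC1 mul1r addrA subrK.
exists (fun e => \sum_(l < B (deg e)) d l e); apply: fpsP => j.
(* Large enough that the remainder [F L] has order above j and that all corrections in degrees at
   most j have been summed. *)
pose L := (j.+1 + B j)%N.
rewrite (fE L) fpsDE (FP L).2 ?add0r; last by rewrite /L; lia.
apply: eq_bigr => e _; set e' := finfun _.
have [je|ej] := ltnP j (deg e').
  by rewrite (_ : (\prod_(i < k) _) = mono y e') ?ordge_mono ?mulr0 //;
     apply: eq_bigr => i _; rewrite !ffunE.
congr (_ * _).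
have BL : (B (deg e') <= L)%N.
  by rewrite /L /B !mulnS; have := leq_mul (leqnn m) ej; lia.
rewrite -(big_mkord xpredT (fun l => d l e')) -(big_mkord xpredT (fun l => d l e')).
rewrite (@big_cat_nat _ _ _ (B (deg e'))) //= [X in _ + X]big_nat_cond.
by rewrite [X in _ + X]big1 ?addr0 // => l; rewrite andbT => /andP[/dB].
Qed.

End PowerSeriesRing.

(** A nonzero generator supplies the finite order m that the removal of leading terms divides by; if
    some generator has a constant term, both sides agree by definition. *)
Lemma ps_ringE (K : fieldType) k (y : 'I_k -> fps K) i :
  y i != 0 -> ps_ring y = gen (range y).
Proof.
move=> yi0; have [pos|npos] := pselect (forall j, pos_ord (y j)); last first.
  by rewrite /ps_ring; case: pselect.
have [m ym] := ord_ex yi0; apply/seteqP; split; last exact: (gen_ps_ring_sub pos ym).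
by rewrite ps_ring_pos // => _ [c ->]; apply: ps_subst_gen.
Qed.

(** * Blow-ups of a branch and their independence of the choices made *)

Section Blowup.
Variable K : fieldType.
Implicit Types (f g x z w : fps K) (A : set (fps K)).

Definition branch_ring A := exists k (y : 'I_k -> fps K) i,
  [/\ forall j, pos_ord (y j), y i != 0 & A = gen (range y)].

(** The quotients by x of the elements of the maximal ideal of A; they describe the blow-up without
    choosing generators of A. *)
Definition quot_gens A x : set (fps K) := [set z | A (x * z) /\ pos_ord (x * z)].

Lemma branch_ring_subalg A : branch_ring A -> is_subalg A.
Proof. by move=> [k [y [i [_ _ ->]]]]; apply: gen_subalg. Qed.

Lemma branch_ring_closed A : branch_ring A -> adic_closed A.
Proof. by move=> [k [y [i [_ _ ->]]]]; apply: gen_closed. Qed.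

Lemma branch_ring_min_ord A : branch_ring A -> exists m, is_min_pos_ord A m.
Proof.
move=> [k [y [i [pos yi0 AE]]]].
pose P m := `[< (0 < m)%N /\ exists2 f, A f & ord f = Some m >].
have ex : exists m, P m.
  have [m ym] := ord_ex yi0; exists m; apply/asboolP; split.
    case: m ym => // /ord_SomeP[_]; have /pos_ordP -> := pos i; by rewrite eqxx.
  by exists (y i) => //; rewrite AE; apply: sub_gen; exists i.
exists (ex_minn ex); case: ex_minnP => m /asboolP[m0 Hm] min; split=> // f Af posf.
case E : (ord f) => [n|] //=; apply: min; apply/asboolP; split; last by exists f.
by move: posf; rewrite /pos_ord E; case: n {E}.
Qed.

Lemma min_ord_uniq A m n : is_min_pos_ord A m -> is_min_pos_ord A n -> m = n.
Proof.
move=> [m0 [f Af fm] Hm] [n0 [g Ag gn] Hn]; apply/eqP; rewrite eqn_leq.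
have := Hm g Ag; have := Hn f Af; rewrite /pos_ord fm gn /ltx /=.
by rewrite -!ltnNge m0 n0 => -> // ->.
Qed.

Lemma gens_quot A k (y z : 'I_k -> fps K) x :
  is_subalg A -> (forall i, pos_ord (y i)) -> (forall i, A (y i)) -> A x ->
  pos_ord x -> (forall i, x * z i = y i) ->
  gen (range (fps_cons x z)) `<=` gen (quot_gens A x).
Proof.
move=> hA pos Ay Ax posx xz; apply: gen_sub => _ [i _ <-]; apply: sub_gen.
rewrite /fps_cons; case: unliftP => [j|] _; first by split; rewrite xz.
split; first exact: subalgM.
by apply/pos_ordP/ordge1P; apply: ordgeMr; apply/ordge1P/pos_ordP.
Qed.

(** The elements c + x v, with c constant and v in G, form a subalgebra containing all y_i = x z_i.
    Positive order forces c = 0, and an approximation modulo t^(m + N) becomes one modulo t^N after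
    division by x. *)
Lemma quot_gens_sub k (y z : 'I_k -> fps K) x m :
  (0 < m)%N -> ord x = Some m -> (forall i, x * z i = y i) ->
  gen (quot_gens (gen (range y)) x) `<=` gen (range (fps_cons x z)).
Proof.
move=> m0 xm xz; set G := gen (range (fps_cons x z)).
have hG : is_subalg G by apply: gen_subalg.
have Gx : G x by apply: sub_gen; exists ord0; rewrite // /fps_cons unlift_none.
have Gz i : G (z i).
  by apply: sub_gen; exists (lift ord0 i); rewrite // /fps_cons liftK.
pose C := [set w | exists c v, G v /\ w = fpsC c + x * v].
have hC : is_subalg C.
  split; last by move=> c; exists c, 0; rewrite mulr0 addr0; split=> //; apply: subalg0 hG.
  split.
  - by exists 1, 0; rewrite mulr0 addr0; split=> //; apply: subalg0 hG.
  - move=> _ _ [c [v [Gv ->]]] [d [w [Gw ->]]]; exists (c - d), (v - w).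
    by split; [apply: (subalgB hG) | rewrite fpsCB; ring].
  - move=> _ _ [c [v [Gv ->]]] [d [w [Gw ->]]].
    exists (c * d), (fpsC c * w + fpsC d * v + x * v * w); split.
      by do !(apply: (subalgD hG) || apply: (subalgM hG)) => //; apply: subalgC.
    by rewrite fpsCM; ring.
apply: gen_min => [//||w [Hw posw]]; first exact: gen_closed.
apply: (@gen_closed _ (range (fps_cons x z))); apply/adic_closureP => N.
have [g Hg xwg] := (adic_closureP _ _).1 Hw (m + N)%N.
have [c [v [Gv gE]]] : C g.
  apply: Hg; split=> // _ [i _ <-]; exists 0, (z i); split=> //.
  by rewrite fpsC0 add0r xz.
have c0 : c = 0.
  have := (ordge_subP _ _ _).1 xwg 0%N; rewrite ((pos_ordP _).1 posw) gE fpsDE fpsCE.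
  have /ordge1P -> : ordge 1 (x * v).
    by apply: ordgeMr; apply: ordge_le (ord_ge xm).
  by rewrite eqxx addr0 => -> //; lia.
exists v => //; apply: (ordge_cancel xm).
by rewrite mulrBr; move: xwg; rewrite gE c0 fpsC0 add0r.
Qed.

(** The quotient u = x' / x is a unit of the closed algebra generated by the quotients by x, and z =
    u^-1 (x' z / x). *)
Lemma quot_gens_indep A x x' m : ord x = Some m -> ord x' = Some m ->
  A x' -> pos_ord x' -> gen (quot_gens A x') `<=` gen (quot_gens A x).
Proof.
move=> xm xm' Ax' posx'; apply: gen_sub => z [Az posz].
have [u xu] := fps_div xm (ord_ge xm').
have Gu : gen (quot_gens A x) u by apply: sub_gen; split; rewrite xu.
have /ord_SomeP[_ u0] : ord u = Some 0%N.
  by apply: (ord_cancel xm); rewrite xu addn0.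
have hG := gen_subalg (quot_gens A x).
have [v Gv uv] := subalg_inv hG (@gen_closed _ _) Gu u0.
have -> : z = v * (u * z) by rewrite mulrA [v * u]mulrC uv mul1r.
by apply: (subalgM hG) => //; apply: sub_gen; rewrite /quot_gens /= mulrA xu.
Qed.

Lemma gen_center k (y : 'I_k -> fps K) :
  gen (range (fun i => y i - fpsC (y i 0%N))) = gen (range y).
Proof.
apply/seteqP; split; apply: gen_sub => _ [i _ <-].
  apply: (subalgB (gen_subalg _)); first by apply: sub_gen; exists i.
  by apply: subalgC; apply: gen_subalg.
set y' := fun i => _; rewrite -(subrK (fpsC (y i 0%N)) (y i)).
apply: (subalgD (gen_subalg _)); first by apply: sub_gen; exists i.
by apply: subalgC; apply: gen_subalg.
Qed.

Section Step.
Variables (A : set (fps K)) (m : nat).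
Hypotheses (HA : branch_ring A) (Am : is_min_pos_ord A m).

Lemma min_ord_pos x : ord x = Some m -> pos_ord x.
Proof. by case: Am => m0 _ _; rewrite /pos_ord => ->; rewrite /ltx /= -ltnNge. Qed.

(** Every admissible choice of generators and of x yields the same closed algebra. Subtracting
    constant terms from x and the z_i gives generators of positive order, with x nonzero among them,
    so blowing up can be iterated. *)
Lemma blowupE x : A x -> ord x = Some m ->
  blowup A = gen (quot_gens A x) /\ branch_ring (blowup A).
Proof.
move=> Ax xm; have posx := min_ord_pos xm.
have [k [y [i [pos yi0 AE]]]] := HA; have [m0 _ Hm] := Am.
have Ay j : A (y j) by rewrite AE; apply: sub_gen; exists j.
have /choice[z xz] : forall j, exists zj, x * zj = y j.
  by move=> j; apply: fps_div xm _; apply/ord_leq; apply: Hm.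
have x0 := ord_Some_neq0 xm.
have consE k' (z' : 'I_k' -> fps K) x' : x' != 0 ->
    ps_ring (fps_cons x' z') = gen (range (fps_cons x' z')).
  by move=> x0'; apply: (@ps_ringE _ _ _ ord0); rewrite /fps_cons unlift_none.
have E : gen (quot_gens A x) = gen (range (fps_cons x z)).
  apply/seteqP; split; first by rewrite AE; apply: (quot_gens_sub m0 xm xz).
  by apply: gens_quot xz => //; apply: branch_ring_subalg.
have B : blowup A = gen (quot_gens A x).
  apply/seteqP; split=> [w|w Hw]; last first.
    exists k, y, z, x; split=> //; last by rewrite consE // -E.
      by split=> //; rewrite AE (ps_ringE yi0).
    by exists m.
  move=> [k' [y' [z' [x' [[pos' AE'] Ax' [m' Am' xm'] xz']]]]].
  rewrite (min_ord_uniq Am' Am) in xm'.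
  rewrite consE ?(ord_Some_neq0 xm') // => Hw.
  apply: (quot_gens_indep xm xm' Ax' (min_ord_pos xm')).
  have Ay' : forall j, A (y' j); last first.
    exact: (gens_quot (branch_ring_subalg HA) pos' Ay' Ax' (min_ord_pos xm') xz' Hw).
  move=> j; rewrite AE' ps_ring_pos //; eexists.
  by rewrite -[LHS]mono1 -(ps_subst_mono pos').
split=> //; rewrite B E; exists k.+1, (fun j => fps_cons x z j - fpsC (fps_cons x z j 0%N)).
exists ord0; split.
- by move=> j; apply/pos_ordP; rewrite fpsBE fpsCE eqxx subrr.
- by rewrite /fps_cons unlift_none ((pos_ordP _).1 posx) fpsC0 subr0.
- by rewrite gen_center.
Qed.

Lemma sub_blowup : A `<=` blowup A.
Proof.
have [m0 [x Ax xm] _] := Am; have [-> _] := blowupE Ax xm => f Af.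
have hG := gen_subalg (quot_gens A x); have hA := branch_ring_subalg HA.
have posx := min_ord_pos xm.
rewrite -(subrK (fpsC (f 0%N)) f); apply: (subalgD hG); last exact: subalgC.
apply: sub_gen; split.
  by apply: (subalgM hA) => //; apply: (subalgB hA) => //; apply: subalgC.
by apply/pos_ordP/ordge1P; apply: ordgeMr; apply/ordge1P/pos_ordP.
Qed.

End Step.

(** What the later arguments use about the successive blow-ups of a branch, kept abstract so that
    the two branches can be exchanged. *)
Definition mult_chain (R : nat -> set (fps K)) (M : nat -> nat) :=
  forall j, (0 < j)%N -> [/\ is_subalg (R j), adic_closed (R j),
    is_min_pos_ord (R j) (M j), R j `<=` R j.+1
    & forall x, R j x -> ord x = Some (M j) -> R j.+1 = gen (quot_gens (R j) x)].

Lemma mult_seq_chain A : branch_ring A ->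
  mult_chain (fun j => iter j.-1 (@blowup K) A) (mult_seq A).
Proof.
move=> HA [//|j] _ /=.
have Hj : branch_ring (iter j (@blowup K) A).
  elim: j => [//|j IH] /=; have [m Hm] := branch_ring_min_ord IH.
  by have [_ [x Ax xm] _] := Hm; case: (blowupE IH Hm Ax xm).
have Mj : is_min_pos_ord (iter j (@blowup K) A) (mult_seq A j.+1).
  by rewrite /mult_seq; have [m Hm] := branch_ring_min_ord Hj; apply: xgetPex; exists m.
split=> //; [exact: branch_ring_subalg|exact: branch_ring_closed| |].
  exact: sub_blowup Mj.
by move=> x Ax xm; case: (blowupE Hj Mj Ax xm).
Qed.

(** * Orders of elements as sums of consecutive multiplicities *)

Section Chain.
Variables (R : nat -> set (fps K)) (M : nat -> nat).
Hypothesis HR : mult_chain R M.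

Lemma mult_gt0 j : (0 < j)%N -> (0 < M j)%N.
Proof. by case/HR => _ _ []. Qed.

Lemma chain_min_elt j : (0 < j)%N -> exists2 x, R j x & ord x = Some (M j).
Proof. by case/HR => _ _ []. Qed.

Lemma chain_min j f : (0 < j)%N -> R j f -> f 0%N = 0 -> ordge (M j) f.
Proof. by case/HR => _ _ [_ _ H] _ _ Rf /pos_ordP posf; apply/ord_leq; apply: H. Qed.

Lemma chain_quot j x z : (0 < j)%N -> R j x -> ord x = Some (M j) ->
  R j (x * z) -> (x * z) 0%N = 0 -> R j.+1 z.
Proof.
move=> /HR[_ _ _ _ H] Rx xM Rxz /pos_ordP pos.
by rewrite (H x Rx xM); apply: sub_gen.
Qed.

(** As long as the order is positive, division by an element of minimal order passes to the next
    level and lowers the order by M_j. *)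
Lemma chain_ord_sum j f n : (0 < j)%N -> R j f -> ord f = Some n ->
  exists2 s, (j <= s)%N & n = (\sum_(j <= i < s) M i)%N.
Proof.
elim/ltn_ind: n j f => n IH j f j0 Rf fn.
have [n0|n0] := posnP n; first by exists j; rewrite // n0 big_geq.
have f0 : f 0%N = 0 by apply: (ord_ge fn).
have fM := chain_min j0 Rf f0; have [x Rx xM] := chain_min_elt j0.
have [z xz] := fps_div xM fM.
have Mn := ord_le_ge fn fM.
have zn : ord z = Some (n - M j)%N.
  by apply: (ord_cancel xM); rewrite xz subnKC.
have Rz : R j.+1 z by apply: (chain_quot j0 Rx xM); rewrite xz.
have Mj0 := mult_gt0 j0.
have [|s js E] := IH (n - M j)%N _ j.+1 z (ltn0Sn j) Rz zn; first by lia.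
by exists s; [exact: ltnW|rewrite big_ltn // -E subnKC].
Qed.

(** An element of order M_k also lies in the next ring of the chain, where its order is a sum of
    multiplicities starting at index k + 1. *)
Lemma chain_seq_s k : (0 < k)%N ->
  (k < seq_s M k)%N /\ M k = (\sum_(k.+1 <= j < (seq_s M k).+1) M j)%N.
Proof.
move=> k0; rewrite /seq_s; case: xgetP => // noex.
have [x Rx xM] := chain_min_elt k0; have [_ _ _ sub _] := HR k0.
have [[|s] ks E] := chain_ord_sum (isT : (0 < k.+1)%N) (sub x Rx) xM; first by lia.
have [eks|ks'] := eqVneq k s; last by case: (noex s); split; [lia|].
by move: E (mult_gt0 k0); rewrite eks big_geq // => ->.
Qed.

(** Both orders are initial sums of multiplicities; as they differ by 1, the first term in the
    difference is 1. An element of order 1 then persists in all later blow-ups. *)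
Lemma chain_eventually1 f g n : R 1 f -> R 1 g -> ord f = Some n ->
  ord g = Some n.+1 -> exists2 L, (0 < L)%N & forall j, (L <= j)%N -> M j = 1%N.
Proof.
move=> Rf Rg fn gn.
have [s s0 ns] := chain_ord_sum (ltn0Sn 0) Rf fn.
have [s' s0' ns'] := chain_ord_sum (ltn0Sn 0) Rg gn.
have ss' : (s < s')%N.
  rewrite ltnNge; apply/negP => s's; have := leqnn n.
  by rewrite [leqLHS]ns (@big_cat_nat _ _ _ s') //= -ns'; lia.
have Ms : M s = 1%N.
  move: ns'; rewrite [RHS](@big_cat_nat _ _ _ s) //=; last exact: ltnW.
  by rewrite -ns big_ltn //; have := mult_gt0 s0; lia.
exists s => // j sj.
have [x Rx x1] : exists2 x, R j x & ord x = Some 1%N.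
  rewrite -(subnKC sj); elim: (j - s)%N => [|d [x Rx x1]].
    by rewrite addn0 -Ms; apply: chain_min_elt.
  exists x => //; rewrite addnS; have [|_ _ _ sub _] := HR (j := (s + d)%N); first by lia.
  exact: sub.
have j0 : (0 < j)%N by apply: leq_trans sj.
have := ord_le_ge x1 (chain_min j0 Rx _).
rewrite (ord_ge x1) // => /(_ erefl); have := mult_gt0 j0; lia.
Qed.

End Chain.

Lemma seq_lengthP (M : nat -> nat) L : (forall j, (L <= j)%N -> M j = 1%N) ->
  (0 < seq_length M)%N /\ forall j, (seq_length M < j)%N -> M j = 1%N.
Proof.
move=> ML; rewrite /seq_length /max_nat_dflt; case: xgetP => [_ -> [[l0 Ml] Hl]|nex].
  split=> // j lj; apply: contrapT => Mj.
  by have := Hl j (conj (leq_trans l0 (ltnW lj)) Mj); lia.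
(* The default case, where the length is 1: an index above it with multiplicity other than 1 would
   yield a largest such index, bounded by L. *)
split=> // j j1; apply: contrapT => Mj.
pose P j := (1 <= j)%N && (M j != 1%N).
have exP : exists j, P j by exists j; rewrite /P ltnW //=; apply/eqP.
have ubP i : P i -> (i <= L)%N.
  by move=> /andP[_ Mi]; rewrite leqNgt; apply: contra Mi => /ltnW/ML ->.
case: (ex_maxnP exP ubP) => i /andP[i1 /eqP Mi] Hi; case: (nex i); split=> // l [l1 Ml].
by apply: Hi; rewrite /P l1; apply/eqP.
Qed.

(** Descending induction from L: each term is the sum of later terms over a range given by the
    common s_k. *)
Lemma eq_seq_s (M M' : nat -> nat) L :
  (forall k, (0 < k)%N -> (k < seq_s M k)%N /\
     M k = (\sum_(k.+1 <= j < (seq_s M k).+1) M j)%N) ->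
  (forall k, (0 < k)%N -> M' k = (\sum_(k.+1 <= j < (seq_s M' k).+1) M' j)%N) ->
  (forall j, (L <= j)%N -> M j = M' j) ->
  (forall k, (0 < k)%N -> seq_s M k = seq_s M' k) ->
  forall j, (0 < j)%N -> M j = M' j.
Proof.
move=> HM HM' ML sE j j0.
have H d : forall i, (0 < i)%N -> (L <= i + d)%N -> M i = M' i.
  elim: d => [|d IH] i i0 Li; first by apply: ML; rewrite -[i]addn0.
  rewrite (HM i i0).2 HM' // sE // big_nat_cond [RHS]big_nat_cond.
  apply: eq_bigr => l; rewrite andbT => /andP[il _]; apply: IH; lia.
by apply: (H L) => //; apply: leq_addl.
Qed.

End Blowup.

(** * Adically closed Arf algebras in the product of two power series rings *)

Section ClosedArf.
Variable K : fieldType.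
Implicit Types (f g x z w : fps2 K) (A B : set (fps2 K)).

Definition ordge2 N f := ordge N f.1 /\ ordge N f.2.
Definition ord2 f (a : nat * nat) := ord f.1 = Some a.1 /\ ord f.2 = Some a.2.
Definition fpsC2 (a : K) : fps2 K := (fpsC a, fpsC a).
Definition closure2 A : set (fps2 K) :=
  [set f | forall N, exists2 g, A g & ordge2 N (f - g)].

Lemma ord2_nu f a : nu f = (Some a.1, Some a.2) <-> ord2 f a.
Proof. by rewrite /nu /ord2; split=> [[]|[-> ->]]. Qed.

(* [carf_arf] says that x^-1 B(nu x) is stable under products. *)
Record closed_arf B : Prop := ClosedArf {
  carfC : forall a, B (fpsC2 a);
  carfB : forall f g, B f -> B g -> B (f - g);
  carf_closed : closure2 B `<=` B;
  carf_arf : forall x z w a, ord2 x a -> B x -> B (x * z) -> B (x * w) ->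
    B (x * z * w) }.

Lemma ord2_1 : ord2 1 (0%N, 0%N).
Proof.
have o1 : ord (1 : fps K) = Some 0%N by apply/ord_SomeP; rewrite fps1E oner_eq0.
by split; apply: o1.
Qed.

Section Basics.
Variable B : set (fps2 K).
Hypothesis HB : closed_arf B.

Lemma carf1 : B 1. Proof. exact: (carfC HB 1). Qed.
Lemma carf0 : B 0. Proof. by rewrite -(subrr 1); apply: carfB HB _ _ carf1 carf1. Qed.
Lemma carfD f g : B f -> B g -> B (f + g).
Proof.
move=> Bf Bg; rewrite -(opprK g); apply: (carfB HB) => //.
by rewrite -sub0r; apply: (carfB HB) => //; apply: carf0.
Qed.
Lemma carfM f g : B f -> B g -> B (f * g).
Proof.
by move=> Bf Bg; have := @carf_arf _ HB 1 f g _ ord2_1 carf1; rewrite !mul1r; apply.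
Qed.

Definition carf_quot x : set (fps2 K) := [set z | B (x * z)].

(** The Arf condition of the quotient at y is the one of B at x y. *)
Lemma carf_quot_closed x a : ord2 x a -> B x -> closed_arf (carf_quot x).
Proof.
move=> xa Bx; split=> [c|f g Bf Bg|f Hf|y z w b yb By Byz Byw].
- by apply: carfM => //; apply: (carfC HB).
- by rewrite /carf_quot /= mulrBr; apply: (carfB HB).
- apply: (carf_closed HB) => N; have [g Bg [fg1 fg2]] := Hf N.
  by exists (x * g) => //; rewrite -mulrBr; split; apply: ordgeMl.
- rewrite /carf_quot /= !mulrA; apply: (@carf_arf _ HB _ z w (a.1 + b.1, a.2 + b.2)%N).
  + by split; apply: ordM; [case: xa|case: yb|case: xa|case: yb].
  + exact: By.
  + by rewrite -mulrA.
  + by rewrite -mulrA.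
Qed.

(* Newton iteration e := e^2 (3 - 2 e) for the idempotents of K[[t]] x K[[u]]. *)
Lemma carf_idempotent f : B f -> f.1 0%N = 0 -> f.2 0%N = 1 -> B (0, 1).
Proof.
move=> Bf f1 f2; apply: (carf_closed HB) => N.
have [g [Bg g1 g2]] : exists g, [/\ B g, ordge N.+1 g.1 & ordge N.+1 (1 - g.2)].
  elim: N => [|N [g [Bg g1 g2]]].
    exists f; split=> //; apply/ordge1P => //.
    by rewrite fpsBE f2 fps1E eqxx subrr.
  exists (g * (g * (1 - g)) + g * (g * (1 - g)) + g * g).
  have B1g : B (1 - g) by apply: (carfB HB) => //; apply: carf1.
  have Bgg : B (g * (g * (1 - g))) by apply: (carfM Bg); apply: carfM.
  split; first by apply: carfD; [apply: carfD|apply: carfM].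
    rewrite (_ : _.1 = g.1 * g.1 * ((1 - g.1) + (1 - g.1) + 1)); last by simpl; ring.
    apply: ordgeMr; apply: ordge_le (ordgeM g1 g1); lia.
  rewrite (_ : 1 - _ = (1 - g.2) * (1 - g.2) * (1 + g.2 + g.2)); last by simpl; ring.
  apply: ordgeMr; apply: ordge_le (ordgeM g2 g2); lia.
exists g => //; split; rewrite /= ?sub0r; first by apply: ordgeN; apply: ordge_le g1.
exact: ordge_le g2.
Qed.

Lemma carf_split_sym : B (0, 1) <-> B (1, 0).
Proof.
by split=> H; [rewrite (_ : (1, 0) = 1 - (0, 1))|rewrite (_ : (0, 1) = 1 - (1, 0))];
   try (by apply: (carfB HB) => //; apply: carf1);
   congr (_, _) => /=; rewrite ?subr0 ?subrr.
Qed.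

(** Otherwise f, scaled to have constant terms (0, 1), would produce an idempotent and the ring
    would be a product. *)
Lemma carf_nonsplit2 f : ~ B (1, 0) -> B f -> f.1 0%N = 0 -> f.2 0%N = 0.
Proof.
move=> nB Bf f1; apply: contrapT => /eqP f2; apply/nB/carf_split_sym.
apply: (@carf_idempotent (fpsC2 (f.2 0%N)^-1 * f)).
- by apply: carfM => //; apply: (carfC HB).
- by rewrite [_.1]/= fpsCME f1 mulr0.
- by rewrite [_.2]/= fpsCME mulVf.
Qed.

Lemma carf_nonsplit1 f : ~ B (1, 0) -> B f -> f.2 0%N = 0 -> f.1 0%N = 0.
Proof.
move=> nB Bf f2.
have : (fpsC2 (f.1 0%N) - f).2 0%N = 0.
  apply: (carf_nonsplit2 nB); last exact: subrr.
  by apply: (carfB HB) => //; apply: (carfC HB).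
by rewrite [LHS](_ : _ = f.1 0%N - f.2 0%N) // f2 subr0.
Qed.

Lemma carf_split_subalg : B (1, 0) -> is_subalg [set f | B (f, 0)].
Proof.
move=> B10; split; last first.
  move=> c /=; rewrite (_ : (_, _) = fpsC2 c * (1, 0)).
    by apply: carfM => //; apply: (carfC HB).
  by congr (_, _); rewrite /= ?mulr1 ?mulr0.
split=> // f g /= Bf Bg.
  by rewrite -[X in (_, X)](subrr 0); apply: carfB HB _ _ Bf Bg.
by rewrite -[X in (_, X)](mulr0 0); apply: carfM Bf Bg.
Qed.

Lemma carf_split_closed : adic_closed [set f | B (f, 0)].
Proof.
move=> f /adic_closureP H; apply: (carf_closed HB) => N.
have [g Bg fg] := H N; exists (g, 0) => //.
by split; rewrite /= ?subr0 //; apply: ordge_0.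
Qed.

End Basics.

Definition swap f : fps2 K := (f.2, f.1).

Lemma closed_arf_swap B : closed_arf B -> closed_arf [set f | B (swap f)].
Proof.
move=> HB; split=> [c|f g Bf Bg|f Hf|x z w a [x1 x2] Bx Bxz Bxw].
- exact: (carfC HB).
- exact: (carfB HB Bf Bg).
- apply: (carf_closed HB) => N; have [g Bg [fg1 fg2]] := Hf N.
  by exists (swap g).
- by apply: (@carf_arf _ HB (swap x) (swap z) (swap w) (a.2, a.1)).
Qed.

(** The product x z w equals (x z)(x w) / x, and division by x loses m = ord x digits of
    precision. *)
Lemma closure2_approx (x z w x' z' w' : fps K) m N L :
  ord x = Some m -> (N + m < L)%N -> ordge L (x - x') ->
  ordge L (x * z - x' * z') -> ordge L (x * w - x' * w') ->
  ordge N (x * z * w - x' * z' * w').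
Proof.
move=> xm NL xx xz xw.
have x'm : ord x' = Some m by apply: ord_close xx => //; lia.
have ww : ordge N (w - w').
  apply: (ordge_cancel x'm).
  rewrite (_ : _ * _ = (x * w - x' * w') - (x - x') * w); last by ring.
  by apply: (@ordge_le _ _ L); [lia|apply: ordgeB => //; apply: ordgeMr].
rewrite (_ : _ - _ = (x * z - x' * z') * w + x' * z' * (w - w')); last by ring.
apply: ordgeD; last exact: ordgeMl.
by apply: (@ordge_le _ _ L); [lia|apply: ordgeMr].
Qed.

(** Close approximations x', r, s in A of x, x z, x w satisfy that x' has the value of x and divides
    r and s; the Arf property of A at x' then gives an approximation of x z w in A. *)
Lemma arf_closure2 A : is_arf A -> (forall a, A (fpsC2 a)) -> closed_arf (closure2 A).
Proof.
move=> [[A1 AB AM] HA] AC.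
have sub f : A f -> closure2 A f.
  by move=> Af N; exists f => //; rewrite subrr; split; apply: ordge_0.
split=> [a|f g Hf Hg N|f Hf N|x z w [m n] [/= x1 x2] Hx Hxz Hxw N].
- exact: sub.
- have [f' Af [f1 f2]] := Hf N; have [g' Ag [g1 g2]] := Hg N.
  exists (f' - g'); first exact: AB.
  rewrite (_ : _ - _ = (f - f') - (g - g')); last by rewrite !opprB; ring.
  by split; apply: ordgeB.
- have [g Hg [fg1 fg2]] := Hf N; have [h Ah [gh1 gh2]] := Hg N.
  by exists h => //; split; [apply: ordge_trans gh1|apply: ordge_trans gh2].
(* Beyond both orders of x, so that these are preserved, with N digits left after division by x. *)
pose L := (N + m + n).+1.
have [x' Ax [xx1 xx2]] := Hx L; have [r Ar [r1 r2]] := Hxz L.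
have [s As [s1 s2]] := Hxw L.
have x1' : ord x'.1 = Some m by apply: ord_close x1 _ xx1; rewrite /L; lia.
have x2' : ord x'.2 = Some n by apply: ord_close x2 _ xx2; rewrite /L; lia.
have div y (y' : fps2 K) : ordge2 L (x * y - y') -> exists z', x' * z' = y'.
  move=> [y1 y2].
  have [|z1 z1E] := @fps_div _ _ y'.1 _ x1'.
    apply: ordge_close y1; [apply: ordgeMr; exact: ord_ge x1|rewrite /L; lia].
  have [|z2 z2E] := @fps_div _ _ y'.2 _ x2'.
    apply: ordge_close y2; [apply: ordgeMr; exact: ord_ge x2|rewrite /L; lia].
  by exists (z1, z2); rewrite [y']surjective_pairing -z1E -z2E.
have [z' zE] := div z r (conj r1 r2); have [w' wE] := div w s (conj s1 s2).
subst r s.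
have [_ _ Hmul] := HA x' (m, n) Ax ((ord2_nu _ (m, n)).2 (conj x1' x2')).
have [||t [At _] tE] := Hmul z' w'.
- exists (x' * z') => //; split=> //; rewrite /vlex /nu x1' x2'.
  by apply/andP; split; apply/ord_leq; apply: ordgeMr; apply: ord_ge.
- exists (x' * w') => //; split=> //; rewrite /vlex /nu x1' x2'.
  by apply/andP; split; apply/ord_leq; apply: ordgeMr; apply: ord_ge.
exists (x' * z' * w'); first by rewrite -mulrA tE.
by split; [apply: (closure2_approx x1 _ xx1 r1 s1)|apply: (closure2_approx x2 _ xx2 r2 s2)];
   rewrite /L; lia.
Qed.

Lemma closure2_values A f a : closure2 A f -> ord2 f a -> value_set A a.
Proof.
move=> /(_ (a.1 + a.2).+1)[g Ag [g1 g2]] [f1 f2]; exists g => //; apply/ord2_nu.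
by split; [apply: ord_close f1 _ g1|apply: ord_close f2 _ g2]; lia.
Qed.

End ClosedArf.

(** * Simultaneous blow-up of the two branches *)

Section TwoChains.
Variable K : fieldType.
Implicit Types (B : set (fps2 K)) (R : nat -> set (fps K)) (M : nat -> nat).

Definition swap_set B : set (fps2 K) := [set f | B (swap f)].

Definition proj1_in B (S1 S2 : set (fps K)) : set (fps K) :=
  [set f | exists g, [/\ B g, S1 g.1, S2 g.2 & g.1 = f]].

Definition dense1 B (S1 S2 : set (fps K)) := S1 `<=` adic_closure (proj1_in B S1 S2).

(* B need not lie in S1 x S2, but its part in S1 x S2 has dense projections. *)
Definition good (S1 S2 : set (fps K)) B :=
  [/\ closed_arf B, dense1 B S1 S2 & dense1 (swap_set B) S2 S1].

Definition has_value B (a : nat * nat) := exists2 f, B f & ord2 f a.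

Lemma good_swap S1 S2 B : good S1 S2 B -> good S2 S1 (swap_set B).
Proof.
move=> [HB H1 H2]; split=> //; first exact: closed_arf_swap.
by rewrite (_ : swap_set (swap_set B) = B) //; apply/seteqP; split=> -[].
Qed.

Lemma has_value_swap B a : has_value (swap_set B) (a.2, a.1) -> has_value B a.
Proof. by move=> [f Bf [f1 f2]]; exists (swap f). Qed.

Lemma proj1_in_subalg B S1 S2 :
  closed_arf B -> is_subalg S1 -> is_subalg S2 -> is_subalg (proj1_in B S1 S2).
Proof.
move=> HB H1 H2; split; last first.
  by move=> a; exists (fpsC2 a); split=> //; [exact: carfC|exact: subalgC|exact: subalgC].
split.
- by exists 1; split=> //; [exact: carf1|exact: subalg1|exact: subalg1].
- move=> _ _ [f [Bf f1 f2 <-]] [g [Bg g1 g2 <-]]; exists (f - g).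
  by split=> //; [exact: carfB|exact: (subalgB H1)|exact: (subalgB H2)].
- move=> _ _ [f [Bf f1 f2 <-]] [g [Bg g1 g2 <-]]; exists (f * g).
  by split=> //; [exact: carfM|exact: (subalgM H1)|exact: (subalgM H2)].
Qed.

(** A quotient of the maximal ideal of the first branch is approximated by dividing an approximation
    g in B. As B does not split, the second component of g has no constant term either, so x divides
    g in both components. *)
Lemma dense1_quot R1 M1 R2 M2 j B (x : fps2 K) :
  mult_chain R1 M1 -> mult_chain R2 M2 -> (0 < j)%N ->
  closed_arf B -> ~ B (1, 0) -> dense1 B (R1 j) (R2 j) ->
  B x -> R1 j x.1 -> R2 j x.2 -> ord2 x (M1 j, M2 j) ->
  dense1 (carf_quot B x) (R1 j.+1) (R2 j.+1).
Proof.
move=> H1 H2 j0 HB nB dB Bx Rx1 Rx2 xM; have [/= x1 x2] := xM.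
have [_ _ _ _ R1E] := H1 j j0; rewrite /dense1 [X in X `<=` _](R1E x.1) //.
apply: gen_min => [||z [Rxz /pos_ordP xz0]].
- apply: adic_closure_subalg; apply: proj1_in_subalg.
  + exact: (carf_quot_closed HB xM Bx).
  + by case: (H1 j.+1).
  + by case: (H2 j.+1).
- exact: adic_closure_closed.
apply/adic_closureP => N.
have [_ [g [Bg g1 g2 <-]] zg] :=
  (adic_closureP _ _).1 (dB _ Rxz) (M1 j + N).+1.
have g10 : g.1 0%N = 0 by rewrite -xz0; apply/esym; apply: (ordge_subP _ _ _).1 zg _ _.
have g20 := carf_nonsplit2 HB nB Bg g10.
have [z1 E1] := fps_div x1 (chain_min H1 j0 g1 g10).
have [z2 E2] := fps_div x2 (chain_min H2 j0 g2 g20).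
exists z1.
  exists (z1, z2); split=> //=.
  - by rewrite /carf_quot /= (_ : x * _ = g) //; case: (g) E1 E2 => ? ? /= <- <-.
  - by apply: (chain_quot H1 j0 Rx1 x1); rewrite E1.
  - by apply: (chain_quot H2 j0 Rx2 x2); rewrite E2.
apply: (ordge_cancel x1); rewrite mulrBr E1.
exact: ordge_le zg.
Qed.

Section Pair.
Variables (R1 R2 : nat -> set (fps K)) (M1 M2 : nat -> nat).
Hypotheses (H1 : mult_chain R1 M1) (H2 : mult_chain R2 M2).

Lemma good_elt1 j B : (0 < j)%N -> good (R1 j) (R2 j) B -> ~ B (1, 0) ->
  exists g, [/\ B g, R1 j g.1, R2 j g.2, ord g.1 = Some (M1 j) & ordge (M2 j) g.2].
Proof.
move=> j0 [HB dB _] nB; have [x Rx xM] := chain_min_elt H1 j0.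
have [_ [g [Bg g1 g2 <-]] xg] := (adic_closureP _ _).1 (dB _ Rx) (M1 j).+1.
have gM := ord_close xM (ltnSn _) xg.
exists g; split=> //; apply: (chain_min H2 j0 g2); apply: (carf_nonsplit2 HB nB Bg).
by apply: (ord_ge gM); apply: mult_gt0 H1 _ j0.
Qed.

End Pair.

Section Step.
Variables (R1 R2 : nat -> set (fps K)) (M1 M2 : nat -> nat).
Hypotheses (H1 : mult_chain R1 M1) (H2 : mult_chain R2 M2).

Lemma nonsplit_swap B : closed_arf B -> ~ B (1, 0) -> ~ swap_set B (1, 0).
Proof. by move=> HB nB /(carf_split_sym HB). Qed.

(** Each branch gives an element of minimal order in its own component and at least minimal order in
    the other. If neither is minimal in both, no cancellation can occur in their sum, which
    therefore is. *)
Lemma good_step j B : (0 < j)%N -> good (R1 j) (R2 j) B -> ~ B (1, 0) ->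
  exists x, [/\ B x, ord2 x (M1 j, M2 j), R1 j x.1 /\ R2 j x.2
    & good (R1 j.+1) (R2 j.+1) (carf_quot B x)].
Proof.
move=> j0 HG nB; have [HB d1 d2] := HG.
have [x [Bx xM x1 x2]] :
    exists x, [/\ B x, ord2 x (M1 j, M2 j), R1 j x.1 & R2 j x.2].
  have [g [Bg g1 g2 gM1 gM2]] := good_elt1 H1 H2 j0 HG nB.
  have [h [Bh h2 h1 hM2 hM1]] :=
    good_elt1 H2 H1 j0 (good_swap HG) (nonsplit_swap HB nB).
  have [gE|gE] := eqVneq (g.2 (M2 j)) 0; last first.
    by exists g; split=> //; split=> //; apply/ord_SomeP.
  have [hE|hE] := eqVneq (h.2 (M1 j)) 0; last first.
    by exists (swap h); split=> //; split=> //; apply/ord_SomeP.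
  have [_ g0] := (ord_SomeP _ _).1 gM1; have [_ h0] := (ord_SomeP _ _).1 hM2.
  have [S1 _ _ _ _] := H1 j0; have [S2 _ _ _ _] := H2 j0.
  exists (g + swap h); split; [exact: carfD| |exact: (subalgD S1)|exact: (subalgD S2)].
  split; apply/ord_SomeP; split.
  - by apply: ordgeD => //; apply: ord_ge.
  - by rewrite [X in X != _](_ : _ = g.1 (M1 j) + h.2 (M1 j)) // hE addr0.
  - by apply: ordgeD => //; apply: ord_ge.
  - by rewrite [X in X != _](_ : _ = g.2 (M2 j) + h.1 (M2 j)) // gE add0r.
exists x; split=> //; split.
- exact: (carf_quot_closed HB xM Bx).
- exact: (dense1_quot H1 H2 j0 HB nB d1 Bx x1 x2 xM).
- have xM' : ord2 (swap x) (M2 j, M1 j) by case: xM.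
  have Bx' : swap_set B (swap x) by case: (x) Bx.
  exact: (@dense1_quot _ _ _ _ _ _ (swap x) H2 H1 j0 (closed_arf_swap HB)
    (nonsplit_swap HB nB) d2 Bx' x2 x1 xM').
Qed.

End Step.

(** Division by an element of minimal order lowers the target order by M_k and moves up one level;
    at level L the powers of an element of order 1 attain every order. *)
Lemma fiber_values R M k L B a : mult_chain R M -> (0 < k <= L)%N -> M L = 1%N ->
  closed_arf B -> B (1, 0) -> (forall f, R k f -> B (f, 0)) ->
  (\sum_(k <= i < L) M i <= a)%N -> exists2 f, B (f, 0) & ord f = Some a.
Proof.
move=> HR + ML; move E : (L - k)%N => d.
elim: d k B a E => [|d IH] k B a E kL HB B10 RB Ha.
  have EkL : k = L by lia.
  have k0 : (0 < k)%N by lia.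
  have [x Rx xM] := chain_min_elt HR k0; rewrite EkL ML in xM.
  exists (x ^+ a); last by rewrite (ordX a xM) muln1.
  by apply: (subalgX (carf_split_subalg HB B10)); apply: RB.
have k0 : (0 < k)%N by lia.
have [x Rx xM] := chain_min_elt HR k0.
have [_ _ _ _ RE] := HR k k0.
(* The divisor is (x, 1) rather than (x, 0), because the Arf condition requires finite orders in
   both components. *)
have BX : B (x, 1).
  have -> : (x, 1) = (x, 0) + (0, 1) :> fps2 K by congr (_, _); rewrite /= ?addr0 ?add0r.
  by apply: carfD => //; [apply: RB|apply/carf_split_sym].
have ordX : ord2 (x, 1) (M k, 0%N) by split=> //; case: (ord2_1 K).
have HB' := carf_quot_closed HB ordX BX.
have quotE f : carf_quot B (x, 1) (f, 0) <-> B (x * f, 0).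
  rewrite /carf_quot /= (_ : (x, 1) * (f, 0) = (x * f, 0)) //.
  by congr (_, _); rewrite /= mulr0.
have B10' : carf_quot B (x, 1) (1, 0) by apply/quotE; rewrite mulr1; apply: RB.
have [f Bf fa] : exists2 f, carf_quot B (x, 1) (f, 0) & ord f = Some (a - M k)%N.
  apply: (IH k.+1) => //; [lia|lia| |].
    rewrite (RE x) //; apply: gen_min.
    - exact: carf_split_subalg.
    - exact: carf_split_closed.
    - by move=> z [Rz _]; apply/quotE; apply: RB.
  by move: Ha; rewrite big_ltn; lia.
exists (x * f); first exact/quotE.
rewrite (ordM xM fa) subnKC //; apply: leq_trans Ha.
by rewrite big_ltn ?leq_addr //; lia.
Qed.

(** * Values attained once the two branches separate *)

Section Coincidence.
Variables (R1 R2 : nat -> set (fps K)) (M1 M2 : nat -> nat) (L1 L2 : nat).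
Hypotheses (H1 : mult_chain R1 M1) (H2 : mult_chain R2 M2).
Hypotheses (ML1 : M1 L1 = 1%N) (ML2 : M2 L2 = 1%N).

Definition all_values k B := forall a,
  (\sum_(k <= i < L1) M1 i <= a.1)%N -> (\sum_(k <= i < L2) M2 i <= a.2)%N ->
  has_value B a.

Lemma dense1_fiber B S1 S2 f : closed_arf B -> B (1, 0) -> dense1 B S1 S2 -> S1 f ->
  B (f, 0).
Proof.
move=> HB B10 dB /dB Hf; apply: (carf_split_closed HB); apply: subset_adic_closure Hf.
move=> _ [g [Bg _ _ <-]] /=; rewrite (_ : (_, _) = g * (1, 0)); first exact: carfM.
by congr (_, _); rewrite /= ?mulr1 ?mulr0.
Qed.

Lemma split_values k B : (0 < k)%N -> (k <= L1)%N -> (k <= L2)%N ->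
  good (R1 k) (R2 k) B -> B (1, 0) -> all_values k B.
Proof.
move=> k0 kL1 kL2 [HB d1 d2] B10 a a1 a2.
have HB' := closed_arf_swap HB.
have B10' : swap_set B (1, 0) by apply/(carf_split_sym HB).
have [||f Bf fa] := fiber_values H1 _ ML1 HB B10 _ a1.
- by rewrite k0.
- by move=> f; apply: (dense1_fiber HB B10 d1).
have [||g Bg ga] := fiber_values H2 _ ML2 HB' B10' _ a2.
- by rewrite k0.
- by move=> g; apply: (dense1_fiber HB' B10' d2).
exists (f, g) => //; rewrite (_ : (f, g) = (f, 0) + (0, g)); first exact: carfD.
by congr (_, _); rewrite /= ?addr0 ?add0r.
Qed.

Lemma quot_values k B x : (k < L1)%N -> (k < L2)%N -> ord2 x (M1 k, M2 k) ->
  all_values k.+1 (carf_quot B x) -> all_values k B.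
Proof.
move=> kL1 kL2 [/= x1 x2] HV a; rewrite (big_ltn kL1) (big_ltn kL2) => a1 a2.
have [||f Bf [/= f1 f2]] := HV (a.1 - M1 k, a.2 - M2 k)%N; rewrite /=; [lia|lia|].
exists (x * f) => //; split.
  by rewrite [_.1]/= (ordM x1 f1) subnKC //; lia.
by rewrite [_.2]/= (ordM x2 f2) subnKC //; lia.
Qed.

(** Division of f by the elements of value (M_1[i], M_2[i]) preserves the hypotheses one level up.
    At level s the quotient has order 0 in the first component and positive order in the second, so
    the ring splits there unless it has split before. *)
Lemma coincidence_values k s B (f : fps2 K) :
  (0 < k <= s)%N -> (s <= L1)%N -> (s <= L2)%N ->
  good (R1 k) (R2 k) B -> B f ->
  ord f.1 = Some (\sum_(k <= i < s) M1 i)%N ->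
  ordge (\sum_(k <= i < s) M2 i).+1 f.2 -> all_values k B.
Proof.
move E : (s - k)%N => d; elim: d k B f E => [|d IH] k B f E ks sL1 sL2 HG Bf f1 f2.
all: have k0 : (0 < k)%N by lia.
all: have kL1 : (k <= L1)%N by lia.
all: have kL2 : (k <= L2)%N by lia.
all: have [B10|nB] := pselect (B (1, 0)); first exact: split_values.
all: have [HB _ _] := HG.
  have f20 : f.2 0%N = 0 by apply: f2.
  have := carf_nonsplit1 HB nB Bf f20.
  by move: f1; rewrite big_geq; [move=> /ord_SomeP[_ /eqP]|lia].
have [x [Bx xM _ HG']] := good_step H1 H2 k0 HG nB; have [/= x1 x2] := xM.
have ks' : (k < s)%N by lia.
rewrite (big_ltn ks') in f1; rewrite (big_ltn ks') in f2.
have [z1 E1] : exists z, x.1 * z = f.1.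
  by apply: fps_div x1 _; apply: ordge_le (ord_ge f1); apply: leq_addr.
have [z2 E2] : exists z, x.2 * z = f.2.
  by apply: fps_div x2 _; apply: ordge_le f2; rewrite leqW // leq_addr.
apply: (quot_values _ _ xM); [lia|lia|].
apply: (IH k.+1 _ (z1, z2)) => //; [lia| | |].
- by rewrite /carf_quot /= (_ : x * _ = f) //; case: (f) E1 E2 => ? ? /= <- <-.
- by apply: (ord_cancel x1); rewrite E1 f1.
- by apply: (ordge_cancel x2); rewrite /= E2 addnS.
Qed.

(** At each level from j to k the ring either splits, which gives the values at once, or admits a
    further blow-up whose values are shifted back. *)
Lemma descend_values j k B : (0 < j)%N -> (j <= k)%N -> (k <= L1)%N -> (k <= L2)%N ->
  (forall B', good (R1 k) (R2 k) B' -> all_values k B') ->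
  good (R1 j) (R2 j) B -> all_values j B.
Proof.
move=> j0 jk kL1 kL2 Hk; move E : (k - j)%N => d.
elim: d j B E j0 jk => [|d IH] j B E j0 jk HG.
  by have jE : j = k by [lia]; subst j; apply: Hk.
have [B10|nB] := pselect (B (1, 0)).
  by apply: split_values => //; lia.
have [x [Bx xM _ HG']] := good_step H1 H2 j0 HG nB.
by apply: (quot_values _ _ xM); [lia|lia|apply: IH => //; lia].
Qed.

(** The element x of value (M_1[k], M_2[k]), seen one level up, has as first order exactly the sum
    of M_1 up to s_{1,k}, while its second order exceeds the sum of M_2 over the same range, since
    s_{2,k} is larger. *)
Lemma seq_s_values k B : (0 < k)%N -> (seq_s M1 k < seq_s M2 k)%N ->
  (seq_s M1 k < L1)%N -> (seq_s M1 k < L2)%N ->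
  good (R1 1) (R2 1) B -> all_values 1 B.
Proof.
move=> k0 s12 sL1 sL2; have [ks1 E1] := chain_seq_s H1 k0.
have [ks2 E2] := chain_seq_s H2 k0.
apply: (@descend_values 1 k) => //; [lia|lia|] => B' HG.
have [B10|nB] := pselect (B' (1, 0)).
  by apply: split_values => //; lia.
have [x [Bx xM _ HG']] := good_step H1 H2 k0 HG nB.
have [/= x1 x2] := xM; have [HB _ _] := HG.
apply: (quot_values _ _ xM); [lia|lia|].
(* The upper index is exclusive, hence the successor; x lies in the quotient of B by x because its
   square lies in B. *)
apply: (@coincidence_values _ (seq_s M1 k).+1 _ x) => //.
- lia.
- exact: (carfM HB Bx Bx).
- by rewrite x1 {1}E1.
- apply: ordge_le (ord_ge x2); rewrite E2.
  rewrite [leqRHS](@big_cat_nat _ _ _ (seq_s M1 k).+1) //=; [|lia|lia].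
  rewrite -addn1 leq_add2l big_ltn; last by lia.
  by rewrite addn_gt0 (mult_gt0 H2).
Qed.

End Coincidence.

Lemma all_values_swap L1 L2 M1 M2 k B :
  all_values M2 M1 L2 L1 k (swap_set B) -> all_values M1 M2 L1 L2 k B.
Proof. by move=> H a a1 a2; apply: has_value_swap; apply: H. Qed.

End TwoChains.

(** * Arf closures, and the branches of a two-branch curve *)

Section Curve.
Variable K : fieldType.
Implicit Types (n : nat) (B : set (fps2 K)).

(** Arf rings are stable under intersection: multiples of x have value at least nu x automatically,
    so z belongs to the quotient by x exactly when x z lies in every ring of the family. *)
Lemma smallest_arf (S : set (fps2 K)) : is_arf (smallest (@is_arf K) S).
Proof.
split.
  split=> [A [[[A1 _ _] _] _]|f g Hf Hg A HA|f g Hf Hg A HA] //.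
    by have [[[_ AB _] _] _] := HA; apply: AB; [apply: Hf|apply: Hg].
  by have [[[_ _ AM] _] _] := HA; apply: AM; [apply: Hf|apply: Hg].
move=> x a Hx xa.
have fwd A z : is_arf A /\ S `<=` A ->
    (exists2 r, smallest (@is_arf K) S r /\ vlex (nu x) (nu r) & x * z = r) ->
    exists2 r, A r /\ vlex (nu x) (nu r) & x * z = r.
  by move=> HA [r [Hr v] E]; exists r => //; split=> //; apply: Hr.
have sub A : is_arf A /\ S `<=` A ->
    is_subring [set z | exists2 r, A r /\ vlex (nu x) (nu r) & x * z = r].
  by move=> HA; apply: HA.1.2 xa; apply: Hx.
have bwd z :
    (forall A, is_arf A /\ S `<=` A ->
       exists2 r, A r /\ vlex (nu x) (nu r) & x * z = r) ->
    vlex (nu x) (nu (x * z)) ->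
    exists2 r, smallest (@is_arf K) S r /\ vlex (nu x) (nu r) & x * z = r.
  move=> H v; exists (x * z) => //; split=> // A HA.
  by have [r [Ar _] ->] := H A HA.
have vx z : vlex (nu x) (nu (x * z)).
  have [x1 x2] := (ord2_nu _ _).1 xa; rewrite /vlex /nu x1 x2.
  by apply/andP; split; apply/ord_leq; apply: ordgeMr; apply: ord_ge.
split=> [|f g Hf Hg|f g Hf Hg]; apply: bwd => // A HA; have [a1 aB aM] := sub A HA.
- exact: a1.
- by apply: aB; apply: fwd.
- by apply: aM; apply: fwd.
Qed.

Lemma ps_ring2_const n (p : 'I_n -> fps2 K) a :
  (forall i, pos_ord (p i).1 /\ pos_ord (p i).2) -> ps_ring2 p (fpsC2 a).
Proof.
move=> pos; exists (fun e => a * (e == [ffun=> 0%N])%:R + 0).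
have E (y : 'I_n -> fps K) : (forall i, pos_ord (y i)) ->
    ps_subst (fun e => a * (e == [ffun=> 0%N])%:R + 0) y = fpsC a.
  move=> posy; rewrite (ps_subst_lin y a _ (fun=> 0)) ps_subst0 addr0.
  by rewrite ps_subst_mono // mono0 mulr1.
by rewrite !E // => i; case: (pos i).
Qed.

Lemma ps_ring2_gen n (p : 'I_n -> fps2 K) i :
  (forall i, pos_ord (p i).1 /\ pos_ord (p i).2) -> ps_ring2 p (p i).
Proof.
move=> pos; exists (fun e => (e == [ffun j => (j == i) : nat])%:R).
rewrite !ps_subst_mono ?mono1; first exact: surjective_pairing.
  by move=> j; case: (pos j).
by move=> j; case: (pos j).
Qed.

(* Because (t, u) lies in the total ring of fractions. *)
Lemma curve_fraction n (p : 'I_n -> fps2 K) : two_branch_curve p ->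
  exists s, ps_ring2 p s /\ exists a, ord2 s a /\
  exists2 r, ps_ring2 p r & ord2 r (a.1.+1, a.2.+1).
Proof.
move=> [_ HC]; pose t := (fpsXn K 1, fpsXn K 1).
have : integral_closure (ps_ring2 p) (to_laurent2 t) by rewrite HC; exists t.
move=> [[r [s [Ar [As _] us E]]] _]; exists s; split=> //.
have {}E : to_laurent2 t * to_laurent2 s = to_laurent2 r by rewrite E divrK.
have [s1 s2] : s.1 != 0 /\ s.2 != 0.
  have := mulVr us; rewrite /to_laurent2 => -[e1 e2].
  by split; apply/eqP => s0; [move/eqP: e1|move/eqP: e2];
     rewrite s0 tofrac0 mulr0 eq_sym oner_eq0.
have [r1 r2] : fpsXn K 1 * s.1 = r.1 /\ fpsXn K 1 * s.2 = r.2.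
  case: E => e1 e2; split; apply/eqP; rewrite -tofrac_eq tofracM; exact/eqP.
have [a1 sa1] := ord_ex s1; have [a2 sa2] := ord_ex s2.
exists (a1, a2); split=> //; exists r => //.
by split; rewrite -?r1 -?r2; apply: (ordM (ord_Xn _ 1)).
Qed.

Lemma ps_subst_all0 n (c : {ffun 'I_n -> nat} -> K) (y : 'I_n -> fps K) m :
  (forall i, y i = 0) -> ps_subst c y m.+1 = 0.
Proof.
move=> y0 /=; rewrite big1 // => e _.
have [/existsP[i ei]|] := boolP [exists i, (0 < e i)%N].
  rewrite (_ : \prod_(j < n) _ = 0) ?fps0E ?mulr0 //.
  by rewrite (bigD1 i) //= y0 -(prednK ei) exprS !mul0r.
rewrite negb_exists => /forallP e0; rewrite big1 ?fps1E ?mulr0 // => i _.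
by have := e0 i; rewrite -eqn0Ngt => /eqP ->; rewrite expr0.
Qed.

(** An element of order a + 1 excludes that all generators vanish, and the consecutive orders a and
    a + 1 force the multiplicities to become 1. *)
Lemma branch_ring_subst n (y : 'I_n -> fps K) c d a : (forall i, pos_ord (y i)) ->
  ord (ps_subst c y) = Some a -> ord (ps_subst d y) = Some a.+1 ->
  [/\ ps_ring y = gen (range y), branch_ring (ps_ring y)
    & exists2 L, (0 < L)%N & forall j, (L <= j)%N -> mult_seq (ps_ring y) j = 1%N].
Proof.
move=> posy ca da.
have [i yi0] : exists i, y i != 0.
  apply: contrapT => H; have /ord_SomeP[_ /eqP] := da; apply.
  by apply: ps_subst_all0 => i; apply/eqP/negP => yi; apply: H; exists i; apply/negP.
have E := ps_ringE yi0; have HR : branch_ring (ps_ring y) by exists n, y, i.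
split=> //; have HC := mult_seq_chain HR.
by apply: (chain_eventually1 HC _ _ ca da) => /=; rewrite ps_ring_pos //; eexists.
Qed.

(** * The bounds b_O and b_D for a curve whose generators lie in a closed Arf algebra *)

Section TwoBranch.
Variables (n : nat) (p : 'I_n -> fps2 K).
Hypothesis Hp : two_branch_curve p.

Let R1 j := iter j.-1 (@blowup K) (branch1 p).
Let R2 j := iter j.-1 (@blowup K) (branch2 p).

Lemma curve_branches :
  [/\ branch1 p = gen (range (fun i => (p i).1)),
      branch2 p = gen (range (fun i => (p i).2)),
      branch_ring (branch1 p) /\ branch_ring (branch2 p)
    & exists2 L, (0 < L)%N & forall j, (L <= j)%N -> M1 p j = 1%N /\ M2 p j = 1%N].
Proof.
have [_ [[c ->] [a [[/= s1 s2] [_ [d ->] [/= r1 r2]]]]]] := curve_fraction Hp.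
have [E1 B1 [L1 L10 HL1]] := branch_ring_subst (fun i => (Hp.1 i).1) s1 r1.
have [E2 B2 [L2 L20 HL2]] := branch_ring_subst (fun i => (Hp.1 i).2) s2 r2.
split=> //; exists (maxn L1 L2); first by lia.
by move=> j Lj; split; [apply: HL1|apply: HL2]; lia.
Qed.

Lemma curve_chain1 : mult_chain R1 (M1 p).
Proof. by apply: mult_seq_chain; case: curve_branches => _ _ []. Qed.

Lemma curve_chain2 : mult_chain R2 (M2 p).
Proof. by apply: mult_seq_chain; case: curve_branches => _ _ []. Qed.

Lemma curve_length :
  (0 < seq_length (M1 p))%N /\
  forall j, ((seq_length (M1 p) < j)%N -> M1 p j = 1%N) /\
            ((seq_length (M2 p) < j)%N -> M2 p j = 1%N).
Proof.
have [_ _ _ [L L0 HL]] := curve_branches.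
have [l1 H1] := seq_lengthP (fun j Lj => (HL j Lj).1).
have [_ H2] := seq_lengthP (fun j Lj => (HL j Lj).2).
by split=> // j; split; [apply: H1|apply: H2].
Qed.

Variable B : set (fps2 K).
Hypotheses (HB : closed_arf B) (Bp : forall i, B (p i)).

Lemma curve_good : good (R1 1) (R2 1) B.
Proof.
have [E1 E2 _ _] := curve_branches.
have [S1 C1 _ _ _] := curve_chain1 (ltn0Sn 0).
have [S2 C2 _ _ _] := curve_chain2 (ltn0Sn 0).
split=> //.
  rewrite /dense1 {1}/R1 /= E1; apply: gen_min => [||_ [i _ <-]].
  - by apply: adic_closure_subalg; apply: proj1_in_subalg.
  - exact: adic_closure_closed.
  - apply: sub_adic_closure; exists (p i); split=> //.
      by rewrite /R1 /= E1; apply: sub_gen; exists i.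
    by rewrite /R2 /= E2; apply: sub_gen; exists i.
rewrite /dense1 {1}/R2 /= E2; apply: gen_min => [||_ [i _ <-]].
- by apply: adic_closure_subalg; apply: proj1_in_subalg => //; apply: closed_arf_swap.
- exact: adic_closure_closed.
- apply: sub_adic_closure; exists (swap (p i)); split=> //.
  + by rewrite /swap_set /swap /= -surjective_pairing.
  + by rewrite /R2 /= E2; apply: sub_gen; exists i.
  + by rewrite /R1 /= E1; apply: sub_gen; exists i.
Qed.

(** The vector b' dominates the conductor by minimality of the latter; the successors account for
    the 1 added to it in the final inequality. *)
Definition bounds_values (b : nat * nat) :=
  exists2 b', b = (b'.1.+1, b'.2.+1) & forall a, vle b' a -> has_value B a.

Lemma bO_values : D12 p !=set0 -> bounds_values (bO p).
Proof.
move=> [k0 Dk0]; rewrite /bO; set d1 := maxn _ _; set d2 := maxn _ _.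
eexists (_, _); first by reflexivity.
move=> a /andP[a1 a2]; rewrite /= in a1 a2.
have [_ Hl] := curve_length.
have [k [k1 sk] kEk] : exists2 k, D12 p k & minn (seq_s (M1 p) k) (seq_s (M2 p) k) = kE p.
  rewrite /kE /min_nat; case: xgetP => [_ -> [[k Dk kE] _]|nex]; first by exists k.
  pose P v := `[< exists2 k, D12 p k & minn (seq_s (M1 p) k) (seq_s (M2 p) k) = v >].
  have ex : exists v, P v by eexists; apply/asboolP; exists k0.
  case: (ex_minnP ex) => v /asboolP Pv Hv; case: (nex v); split=> // w Pw.
  by apply: Hv; apply/asboolP.
(* The sums in b_O include the index d_i, so the exclusive end is d_i + 1; it lies beyond the length
   of the sequence and beyond k_E, the smaller of the two s_{i,k}. *)
have ML1 : M1 p d1.+1 = 1%N by apply: (Hl _).1; rewrite ltnS leq_maxl.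
have ML2 : M2 p d2.+1 = 1%N by apply: (Hl _).2; rewrite ltnS leq_maxl.
have kd1 : (kE p <= d1)%N by apply: leq_maxr.
have kd2 : (kE p <= d2)%N by apply: leq_maxr.
have [lt|gt|/sk //] := ltngtP (seq_s (M1 p) k) (seq_s (M2 p) k).
  by apply: (seq_s_values curve_chain1 curve_chain2 ML1 ML2 k1 lt _ _ curve_good) => //; lia.
apply: (all_values_swap (L1 := d1.+1) (L2 := d2.+1) (k := 1)) a1 a2.
by apply: (seq_s_values curve_chain2 curve_chain1 ML2 ML1 k1 gt _ _ (good_swap curve_good));
  lia.
Qed.

Lemma curve_eq_mult j : D12 p = set0 -> (0 < j)%N -> M1 p j = M2 p j.
Proof.
move=> D0; have [_ _ _ [L L0 HL]] := curve_branches.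
apply: (@eq_seq_s (M1 p) (M2 p) L).
- exact: chain_seq_s curve_chain1.
- by move=> k k0; case: (chain_seq_s curve_chain2 k0).
- by move=> i /HL[-> ->].
- move=> k k0; apply: contrapT => sk.
  by have : D12 p k by []; rewrite D0.
Qed.

(** A generator attaining D has order D in one component and a larger one in the other. As D is an
    initial sum of the common multiplicities, this generator separates the branches. *)
Lemma bD_values : D12 p = set0 -> Dis p !=set0 -> bounds_values (bD p).
Proof.
move=> D0 [i0 Di0]; rewrite /bD; set cr := (\sum_(_ <= _ < _) _)%N.
eexists (_, _); first by reflexivity.
move=> a /andP[a1 a2]; rewrite /= in a1 a2.
have [l0 Hl] := curve_length; have eqM j := @curve_eq_mult j D0.
have sumM s : (\sum_(1 <= i < s) M2 p i = \sum_(1 <= i < s) M1 p i)%N.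
  rewrite big_nat_cond [RHS]big_nat_cond; apply: eq_bigr => i.
  by rewrite andbT => /andP[i1 _]; rewrite eqM.
have [i Di dE] : exists2 i, Dis p i & Some (Dmin p) = minx (ord (p i).1) (ord (p i).2).
  rewrite /Dmin /min_nat; case: xgetP => [_ -> [] //|nex].
  pose P v := `[< exists2 i, Dis p i & Some v = minx (ord (p i).1) (ord (p i).2) >].
  have ex : exists v, P v.
    move: Di0; rewrite /Dis /= => Di0.
    (* An infinite minimum would make both orders infinite, hence equal. *)
    case E : (minx (ord (p i0).1) (ord (p i0).2)) => [v|].
      by exists v; apply/asboolP; exists i0.
    by case: Di0; move: E; rewrite /minx; case: (ord _.1) (ord _.2) => [u|] [v|] //=;
       case: ifP.
  case: (ex_minnP ex) => v /asboolP Pv Hv; case: (nex v); split=> // w Pw.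
  by apply: Hv; apply/asboolP.
(* Initial sums are monotone, so the one below the larger of two indices is the larger of the two
   sums; with D equal to the sum below s this is max(c_r, D). *)
have bigL s : let L := maxn (seq_length (M1 p)).+1 s in
    (\sum_(1 <= i < L) M1 p i = maxn cr (\sum_(1 <= i < s) M1 p i))%N.
  have le u v : (u <= v)%N -> (\sum_(1 <= i < u) M1 p i <= \sum_(1 <= i < v) M1 p i)%N.
    case: u => [|u] uv; first by rewrite big_geq.
    by rewrite [leqRHS](@big_cat_nat _ _ _ u.+1) //= leq_addr.
  have [ls|sl] := leqP (seq_length (M1 p)).+1 s.
    by rewrite /= (maxn_idPr _) //; apply: le.
  by rewrite /= (maxn_idPl _) //; apply: le; apply: ltnW.
(* Stated for arbitrary chains, so as to apply whichever component has the smaller order. *)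
have key R R' M M' (q : fps2 K) B' : mult_chain R M -> mult_chain R' M' ->
    (forall j, (0 < j)%N -> M j = M1 p j) -> (forall j, (0 < j)%N -> M' j = M1 p j) ->
    good (R 1) (R' 1) B' -> B' q -> R 1 q.1 -> ord q.1 = Some (Dmin p) ->
    ordge (Dmin p).+1 q.2 -> forall b : nat * nat, (maxn cr (Dmin p) <= b.1)%N ->
    (maxn cr (Dmin p) <= b.2)%N -> has_value B' b.
  move=> HR HR' MM MM' HG Bq Rq q1 q2 b b1 b2.
  have sE (N : nat -> nat) s : (forall j, (0 < j)%N -> N j = M1 p j) ->
      (\sum_(1 <= i < s) N i = \sum_(1 <= i < s) M1 p i)%N.
    move=> H; rewrite big_nat_cond [RHS]big_nat_cond; apply: eq_bigr => j.
    by rewrite andbT => /andP[j1 _]; rewrite H.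
  have [s s1 ds] := chain_ord_sum HR (ltn0Sn 0) Rq q1.
  rewrite sE // in ds; pose L := maxn (seq_length (M1 p)).+1 s.
  have ML : M1 p L = 1%N by apply: (Hl _).1; apply: leq_maxl.
  have L0 : (0 < L)%N by rewrite /L; lia.
  have sL : (s <= L)%N by apply: leq_maxr.
  apply: (@coincidence_values _ R R' M M' L L HR HR' _ _ 1 s B' q) => //.
  - by rewrite MM.
  - by rewrite MM'.
  - by rewrite q1 sE // ds.
  - by rewrite sE // -ds.
  - by rewrite sE // bigL -ds.
  - by rewrite sE // bigL -ds.
have lt_ordge (f g : fps K) d : ord f = Some d -> ord f <> ord g ->
    leqx (ord f) (ord g) -> ordge d.+1 g.
  move=> fd; rewrite fd => ne le m; rewrite ltnS leq_eqVlt => /orP[/eqP ->|].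
    apply: contrapT => /eqP gd; apply: ne; apply/esym/ord_SomeP; split=> //.
    exact/ord_leq.
  by apply: (ord_leq _ _).1 le m.
have HG := curve_good; have [E1 E2 _ _] := curve_branches.
have Rp1 : R1 1 (p i).1 by rewrite /R1 /= E1; apply: sub_gen; exists i.
have Rp2 : R2 1 (p i).2 by rewrite /R2 /= E2; apply: sub_gen; exists i.
move: dE; rewrite /minx; case: ifP => le /esym dE.
  apply: (key R1 R2 (M1 p) (M2 p) (p i)) => //.
  - exact: curve_chain1.
  - exact: curve_chain2.
  - by move=> j j0; rewrite eqM.
  - exact: lt_ordge dE Di le.
apply: has_value_swap.
apply: (key R2 R1 (M2 p) (M1 p) (swap (p i))) => //.
- exact: curve_chain2.
- exact: curve_chain1.
- by move=> j j0; rewrite eqM.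
- exact: good_swap.
- by rewrite /swap_set /swap /= -surjective_pairing.
- apply: (lt_ordge (p i).2) => //; first by move/esym.
  by move: le; case: (ord _.1) (ord _.2) => [u|] [v|] //= /negbT; rewrite -ltnNge => /ltnW.
Qed.

End TwoBranch.

(** * The reduction process and the bound b_G *)

Lemma reduction_step_in n (p q : 'I_n -> fps2 K) B : closed_arf B ->
  (forall i, B (p i)) -> reduction_step p q ->
  two_branch_curve q /\ forall i, B (q i).
Proof.
move=> HB Bp [sigma [i1 [i [a [b [r [s [_ _ _ _ [-> Hq]]]]]]]]]; split=> // j /=.
have BX f m : B f -> B (f ^+ m).
  move=> Bf; elim: m => [|m IH]; first by rewrite expr0; apply: carf1.
  by rewrite exprS; apply: carfM.
case: ifP => _ //; apply: carfD => //; apply: carfM => //;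
  by [apply: (carfC HB)|apply: BX].
Qed.

(** The bounds hold for every closed Arf algebra containing the generators, so B stays fixed while
    the curve shrinks. *)
Lemma reduces_to_values n (p : 'I_n -> fps2 K) b B : closed_arf B ->
  (forall i, B (p i)) -> reduces_to p b -> bounds_values B b.
Proof.
move=> HB + H; elim: H => {p b} p b q pq.
- by move=> Dq -> Bp; have [Hq Bq] := reduction_step_in HB Bp pq; apply: bO_values.
- by move=> Dq Disq -> Bp; have [Hq Bq] := reduction_step_in HB Bp pq; apply: bD_values.
- by move=> _ _ _ IH Bp; apply: IH; case: (reduction_step_in HB Bp pq).
Qed.

End Curve.

Theorem proposition4p8 (K : fieldType) (n : nat) (p : 'I_n -> fps2 K)
    (c b : nat * nat)
    (K_infinite : infinite_set [set: K])
    (R_curve : two_branch_curve p)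
    (c_conductor : is_conductor (value_set (arf_closure (ps_ring2 p))) c)
    (b_bound : is_bound p b) :
  vle (c.1 + 1, c.2 + 1)%N b.
Proof.
have pos := R_curve.1; set A := arf_closure (ps_ring2 p) in c_conductor.
have RA : ps_ring2 p `<=` A by move=> f Rf C [_]; apply.
have HA : closed_arf (closure2 A).
  by apply: arf_closure2 => [|a]; [apply: smallest_arf|apply: RA; apply: ps_ring2_const].
have Ap i : closure2 A (p i).
  move=> N; exists (p i); first by apply: RA; apply: ps_ring2_gen.
  by rewrite subrr; split; apply: ordge_0.
(* Finite values do not change under adic closure, so the minimality of c applies to the values
   found in the closure. *)
have conc b' : bounds_values (closure2 A) b' -> vle (c.1 + 1, c.2 + 1)%N b'.
  move=> [d -> Hd]; rewrite /vle /= !addn1 !ltnS; apply: c_conductor.2 => a da.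
  by have [f Af fa] := Hd a da; apply: closure2_values Af fa.
case: b_bound => [D12 ->|bG D12 Dis red ->|_ _ red].
- by apply: conc; apply: bO_values.
- have := conc _ (bD_values R_curve HA Ap D12 Dis).
  have := conc _ (reduces_to_values HA Ap red).
  by rewrite /vle /vmin /= !leq_min => /andP[-> ->] /andP[-> ->].
- exact: conc _ (reduces_to_values HA Ap red).
Qed.
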